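(* The quasivariety of $\mathcal{L}'$-local $\mathcal{L}$-unimodal algebras is generated as a universal class by the class of all complex algebras of $\mathcal{L}'$-local $\mathcal{L}$-unimodal frames.
   Context: $\mathcal{L}\subseteq\{\Box_+,\Box_-,\Diamond_+,\Diamond_-\}$ is a set of forward modalities on bounded distributive lattices ($\Box_+$ preserves finite meets; $\Diamond_+$ finite joins; $\Box_-(a\vee b)=\Box_-a\wedge\Box_-b$, $\Box_-\bot=\top$; $\Diamond_-(a\wedge b)=\Diamond_-a\vee\Diamond_-b$, $\Diamond_-\top=\bot$). Backward modalities are written $\overleftarrow{\Box}_\alpha,\overleftarrow{\Diamond}_\alpha$; the adjoint pairs are $(\Box_+,\overleftarrow{\Diamond}_+)$, $(\Diamond_+,\overleftarrow{\Box}_+)$, $(\Box_-,\overleftarrow{\Box}_-)$, $(\Diamond_-,\overleftarrow{\Diamond}_-)$. $\mathcal{L}'$ is a set of forward and/or backward modalities, each a modality of $\mathcal{L}$ or adjoint to one in $\mathcal{L}$. An $\mathcal{L}$-unimodal algebra is an $\mathcal{L}$-modal algebra satisfying, for all pairs of modalities in $\mathcal{L}$, the quasiequations: $\Box_-a\wedge\Box_+(a\vee b)\le\Box_+b$; $\Box_+a\wedge\Box_-(a\wedge b)\le\Box_-b$; $\Diamond_+b\le\Diamond_+(a\wedge b)\vee\Diamond_-a$; $\Diamond_-b\le\Diamond_-(a\vee b)\vee\Diamond_+a$; $\Diamond_-a\wedge c\le\Box_+a\Rightarrow c\le\Box_+a$; $\Diamond_+a\wedge c\le\Box_-a\Rightarrow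 c\le\Box_-a$; $\Diamond_+a\le\Box_-a\vee c\Rightarrow\Diamond_+a\le c$; $\Diamond_-a\le\Box_+a\vee c\Rightarrow\Diamond_-a\le c$; $\Diamond_+b\wedge c\le\Box_+a\Rightarrow\Box_+(a\vee b)\wedge c\le\Box_+a$; $\Diamond_-b\wedge c\le\Box_-a\Rightarrow\Box_-(a\wedge b)\wedge c\le\Box_-a$; $\Diamond_+a\le\Box_+b\vee c\Rightarrow\Diamond_+a\le\Diamond_+(a\wedge b)\vee c$; $\Diamond_-a\le\Box_-b\vee c\Rightarrow\Diamond_-a\le\Diamond_-(a\vee b)\vee c$. An $\mathcal{L}$-unimodal frame is a poset $(W,\le)$ with a relation $R$ generating $R^\Box_+={\le}\circ R\circ{\le}$, $R^\Diamond_+={\ge}\circ R\circ{\ge}$, $R^\Box_-={\le}\circ R\circ{\ge}$, $R^\Diamond_-={\ge}\circ R\circ{\le}$ for the modalities in $\mathcal{L}$ (with $R=\bigcap R^\Delta_\alpha$); its complex algebra is the (bi-Heyting) lattice of upsets with $\Box_+a=\{u:uR^\Box_+v\Rightarrow v\in a\}$, $\Box_-a=\{u:uR^\Box_-v\Rightarrow v\notin a\}$, $\Diamond_+a=\{u:\exists v\in a,uR^\Diamond_+v\}$, $\Diamond_-a=\{u:\exists v\notin a,uR^\Diamond_-v\}$. Locality frame conditions: $(\Diamond_+)^*$: ${\ge}\circ R\subseteq R\circ{\ge}$; $(\Diamond_-)^*$: ${\ge}\circ R\subseteq R\circ{\le}$; $(\Box_+)^*$: ${\le}\circ R\subseteq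 R\circ{\le}$; $(\Box_-)^*$: ${\le}\circ R\subseteq R\circ{\ge}$; $(\overleftarrow{\Diamond}_+)^*$: $R\circ{\le}\subseteq{\le}\circ R$; $(\overleftarrow{\Diamond}_-)^*$: $R\circ{\le}\subseteq{\ge}\circ R$; $(\overleftarrow{\Box}_+)^*$: $R\circ{\ge}\subseteq{\ge}\circ R$; $(\overleftarrow{\Box}_-)^*$: $R\circ{\ge}\subseteq{\le}\circ R$. An $\mathcal{L}'$-local $\mathcal{L}$-unimodal frame satisfies $(\Delta_\alpha)^*$ for each $\Delta_\alpha\in\mathcal{L}'$. Algebraic locality equations ($\rightarrow$ Heyting implication, $-$ co-implication): $(\Diamond_+,\Box_+)^*$: $\Box_+a\wedge\Diamond_+b\le\Diamond_+(a\wedge b)$; $(\Diamond_-,\Box_-)^*$: $\Box_-a\wedge\Diamond_-b\le\Diamond_-(a\vee b)$; $(\Box_+,\Diamond_+)^*$: $\Box_+(a\vee b)\le\Box_+a\vee\Diamond_+b$; $(\Box_-,\Diamond_-)^*$: $\Box_-(a\wedge b)\le\Box_-a\vee\Diamond_-b$; $(\Diamond_+,\Box_-)^*$: $\Box_-a\wedge\Diamond_+a\le\bot$; $(\Diamond_-,\Box_+)^*$: $\Box_+a\wedge\Diamond_-a\le\bot$; $(\Box_+,\Diamond_-)^*$: $\top\le\Box_+a\vee\Diamond_-a$; $(\Box_-,\Diamond_+)^*$: $\top\le\Box_-a\vee\Diamond_+a$; $(\overleftarrow{\Diamond}_+,\overleftarrow{\Box}_+)^*$: $\Diamond_+a\rightarrow\Box_+b\le\Box_+(a\rightarrow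 b)$; $(\overleftarrow{\Diamond}_-,\overleftarrow{\Box}_-)^*$: $\Diamond_-(a\rightarrow b)\le\Diamond_-b-\Box_-a$; $(\overleftarrow{\Box}_+,\overleftarrow{\Diamond}_+)^*$: $\Diamond_+(b-a)\le\Diamond_+b-\Box_+a$; $(\overleftarrow{\Box}_-,\overleftarrow{\Diamond}_-)^*$: $\Diamond_-a\rightarrow\Box_-b\le\Box_-(b-a)$; $(\overleftarrow{\Diamond}_+,\overleftarrow{\Box}_-)^*$: $\Box_-a\le\Box_+(a\rightarrow\bot)$; $(\overleftarrow{\Diamond}_-,\overleftarrow{\Box}_+)^*$: $\Diamond_-(a\rightarrow\bot)\le\Diamond_+a$; $(\overleftarrow{\Box}_+,\overleftarrow{\Diamond}_-)^*$: $\Diamond_+(\top-a)\le\Diamond_-a$; $(\overleftarrow{\Box}_-,\overleftarrow{\Diamond}_+)^*$: $\Box_+a\le\Box_-(\top-a)$. An algebra satisfies $(\Delta_\alpha)^*$ if it satisfies $(\Delta_\alpha,\nabla_\alpha)^*$ and $(\Delta_\alpha,\nabla_{-\alpha})^*$ whenever the modalities these equations involve are available ($\nabla$ the opposite symbol: $\Box\leftrightarrow\Diamond$, $\overleftarrow{\Box}\leftrightarrow\overleftarrow{\Diamond}$; the backward equations involve the forward modalities adjoint to the backward symbols), and it is appropriate for $(\Delta_\alpha)^*$ if it is a Heyting/co-Heyting/bi-Heyting algebra as required by the connectives of those equations. An $\mathcal{L}'$-local $\mathcal{L}$-unimodal algebra is an $\mathcal{L}$-unimodal algebra appropriate for and satisfying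 $(\Delta_\alpha)^*$ for each $\Delta_\alpha\in\mathcal{L}'$. *)

(* Defs.v *)
From Stdlib Require Import Bool List Relations.
Import ListNotations.

Set Implicit Arguments.
Coercion is_true : bool >-> Sortclass.

(** * Modalities *)

Inductive sign := pos | neg.
Inductive fmod := box (s : sign) | dia (s : sign).

(** [bwd (box s)] and [bwd (dia s)] are the backward modalities written with
    the symbols box and diamond of sign [s]. *)
Inductive modality := fwd (m : fmod) | bwd (m : fmod).

Definition adjoint (m : fmod) : fmod :=
  match m with
  | box pos => dia pos
  | dia pos => box pos
  | box neg => box neg
  | dia neg => dia neg
  end.

(** The forward modality which must be present for a given modality to make
    sense: itself, or the forward adjoint of a backward modality. *)
Definition base (m : modality) : fmod :=
  match m with fwd m => m | bwd m => adjoint m end.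

Definition opposite (m : modality) (s : sign) : modality :=
  match m with
  | fwd (box _) => fwd (dia s)
  | fwd (dia _) => fwd (box s)
  | bwd (box _) => bwd (dia s)
  | bwd (dia _) => bwd (box s)
  end.

(** * Signatures and algebras *)

Record signature := Signature {
  modals : fmod -> bool;
  has_imp : bool;
  has_coimp : bool
}.

(** An arbitrary first-order structure of the given signature; an operation
    exists only if its symbol belongs to the signature. *)
Record algebra (S : signature) := Algebra {
  carrier :> Type;
  bot : carrier;
  top : carrier;
  meet : carrier -> carrier -> carrier;
  join : carrier -> carrier -> carrier;
  imp : has_imp S -> carrier -> carrier -> carrier;
  coimp : has_coimp S -> carrier -> carrier -> carrier;
  modal : forall m : fmod, modals S m -> carrier -> carrier
}.
Arguments bot {S a}.
Arguments top {S a}.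
Arguments meet {S a}.
Arguments join {S a}.
Arguments imp {S a}.
Arguments coimp {S a}.
Arguments modal {S} a m.

Definition leq {S} {A : algebra S} (a b : A) : Prop := meet a b = a.

Notation "a ⊓ b" := (meet a b) (at level 40, left associativity).
Notation "a ⊔ b" := (join a b) (at level 50, left associativity).
Notation "a ⊑ b" := (leq a b) (at level 70, no associativity).

Record bounded_distributive_lattice {S} (A : algebra S) : Prop := {
  meetA : forall a b c : A, a ⊓ (b ⊓ c) = a ⊓ b ⊓ c;
  meetC : forall a b : A, a ⊓ b = b ⊓ a;
  joinA : forall a b c : A, a ⊔ (b ⊔ c) = a ⊔ b ⊔ c;
  joinC : forall a b : A, a ⊔ b = b ⊔ a;
  meet_join_absorb : forall a b : A, a ⊓ (a ⊔ b) = a;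
  join_meet_absorb : forall a b : A, a ⊔ (a ⊓ b) = a;
  meet_join_distr : forall a b c : A, a ⊓ (b ⊔ c) = (a ⊓ b) ⊔ (a ⊓ c);
  join_bot : forall a : A, a ⊔ bot = a;
  meet_top : forall a : A, a ⊓ top = a
}.

Definition when1 {S} (A : algebra S) (m : fmod) (P : (A -> A) -> Prop) : Prop :=
  forall h : modals S m, P (modal A m h).

Definition when2 {S} (A : algebra S) (m n : fmod)
    (P : (A -> A) -> (A -> A) -> Prop) : Prop :=
  forall (h : modals S m) (k : modals S n), P (modal A m h) (modal A n k).

Record modal_algebra {S} (A : algebra S) : Prop := {
  modal_lattice : bounded_distributive_lattice A;
  box_pos : when1 A (box pos) (fun B =>
    (forall a b, B (a ⊓ b) = B a ⊓ B b) /\ B top = top);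
  dia_pos : when1 A (dia pos) (fun D =>
    (forall a b, D (a ⊔ b) = D a ⊔ D b) /\ D bot = bot);
  box_neg : when1 A (box neg) (fun B =>
    (forall a b, B (a ⊔ b) = B a ⊓ B b) /\ B bot = top);
  dia_neg : when1 A (dia neg) (fun D =>
    (forall a b, D (a ⊓ b) = D a ⊔ D b) /\ D top = bot)
}.

(** In the names of bound operations, a prime marks negative sign. *)
Record unimodal_algebra {S} (A : algebra S) : Prop := {
  unimodal_modal : modal_algebra A;
  unimodal1 : when2 A (box neg) (box pos) (fun B' B =>
    forall a b, B' a ⊓ B (a ⊔ b) ⊑ B b);
  unimodal2 : when2 A (box pos) (box neg) (fun B B' =>
    forall a b, B a ⊓ B' (a ⊓ b) ⊑ B' b);
  unimodal3 : when2 A (dia pos) (dia neg) (fun D D' =>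
    forall a b, D b ⊑ D (a ⊓ b) ⊔ D' a);
  unimodal4 : when2 A (dia neg) (dia pos) (fun D' D =>
    forall a b, D' b ⊑ D' (a ⊔ b) ⊔ D a);
  unimodal5 : when2 A (dia neg) (box pos) (fun D' B =>
    forall a c, D' a ⊓ c ⊑ B a -> c ⊑ B a);
  unimodal6 : when2 A (dia pos) (box neg) (fun D B' =>
    forall a c, D a ⊓ c ⊑ B' a -> c ⊑ B' a);
  unimodal7 : when2 A (dia pos) (box neg) (fun D B' =>
    forall a c, D a ⊑ B' a ⊔ c -> D a ⊑ c);
  unimodal8 : when2 A (dia neg) (box pos) (fun D' B =>
    forall a c, D' a ⊑ B a ⊔ c -> D' a ⊑ c);
  unimodal9 : when2 A (dia pos) (box pos) (fun D B =>
    forall a b c, D b ⊓ c ⊑ B a -> B (a ⊔ b) ⊓ c ⊑ B a);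
  unimodal10 : when2 A (dia neg) (box neg) (fun D' B' =>
    forall a b c, D' b ⊓ c ⊑ B' a -> B' (a ⊓ b) ⊓ c ⊑ B' a);
  unimodal11 : when2 A (dia pos) (box pos) (fun D B =>
    forall a b c, D a ⊑ B b ⊔ c -> D a ⊑ D (a ⊓ b) ⊔ c);
  unimodal12 : when2 A (dia neg) (box neg) (fun D' B' =>
    forall a b c, D' a ⊑ B' b ⊔ c -> D' a ⊑ D' (a ⊔ b) ⊔ c)
}.

(** * Algebraic locality *)

(** [locality_eq A m s] is the equation attached to [m] and [opposite m s],
    imposed if the modalities involved are available in the signature. *)
Definition locality_eq {S} (A : algebra S) (m : modality) (s : sign) : Prop :=
  match m, s with
  | fwd (dia pos), pos => when2 A (box pos) (dia pos) (fun B D =>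
      forall a b, B a ⊓ D b ⊑ D (a ⊓ b))
  | fwd (dia neg), neg => when2 A (box neg) (dia neg) (fun B' D' =>
      forall a b, B' a ⊓ D' b ⊑ D' (a ⊔ b))
  | fwd (box pos), pos => when2 A (box pos) (dia pos) (fun B D =>
      forall a b, B (a ⊔ b) ⊑ B a ⊔ D b)
  | fwd (box neg), neg => when2 A (box neg) (dia neg) (fun B' D' =>
      forall a b, B' (a ⊓ b) ⊑ B' a ⊔ D' b)
  | fwd (dia pos), neg => when2 A (box neg) (dia pos) (fun B' D =>
      forall a, B' a ⊓ D a ⊑ bot)
  | fwd (dia neg), pos => when2 A (box pos) (dia neg) (fun B D' =>
      forall a, B a ⊓ D' a ⊑ bot)
  | fwd (box pos), neg => when2 A (box pos) (dia neg) (fun B D' =>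
      forall a, top ⊑ B a ⊔ D' a)
  | fwd (box neg), pos => when2 A (box neg) (dia pos) (fun B' D =>
      forall a, top ⊑ B' a ⊔ D a)
  | bwd (dia pos), pos => when2 A (box pos) (dia pos) (fun B D =>
      forall i a b, imp i (D a) (B b) ⊑ B (imp i a b))
  | bwd (dia neg), neg => when2 A (box neg) (dia neg) (fun B' D' =>
      forall i j a b, D' (imp i a b) ⊑ coimp j (D' b) (B' a))
  | bwd (box pos), pos => when2 A (box pos) (dia pos) (fun B D =>
      forall j a b, D (coimp j b a) ⊑ coimp j (D b) (B a))
  | bwd (box neg), neg => when2 A (box neg) (dia neg) (fun B' D' =>
      forall i j a b, imp i (D' a) (B' b) ⊑ B' (coimp j b a))
  | bwd (dia pos), neg => when2 A (box neg) (box pos) (fun B' B =>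
      forall i a, B' a ⊑ B (imp i a bot))
  | bwd (dia neg), pos => when2 A (dia neg) (dia pos) (fun D' D =>
      forall i a, D' (imp i a bot) ⊑ D a)
  | bwd (box pos), neg => when2 A (dia pos) (dia neg) (fun D D' =>
      forall j a, D (coimp j top a) ⊑ D' a)
  | bwd (box neg), pos => when2 A (box pos) (box neg) (fun B B' =>
      forall j a, B a ⊑ B' (coimp j top a))
  end.

(** The connectives occurring in [locality_eq _ m s]. *)
Definition uses_imp (m : modality) (s : sign) : bool :=
  match m, s with
  | bwd (dia _), _ | bwd (box neg), neg => true
  | _, _ => false
  end.

Definition uses_coimp (m : modality) (s : sign) : bool :=
  match m, s with
  | bwd (box _), _ | bwd (dia neg), neg => true
  | _, _ => false
  end.

Definition in_force (L : fmod -> bool) (L' : modality -> bool)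
    (m : modality) (s : sign) : bool :=
  L' m && L (base m) && L (base (opposite m s)).

Definition all_fmods : list fmod := [box pos; box neg; dia pos; dia neg].
Definition all_modalities : list modality :=
  map fwd all_fmods ++ map bwd all_fmods.

Definition requires (uses : modality -> sign -> bool)
    (L : fmod -> bool) (L' : modality -> bool) : bool :=
  existsb (fun m => existsb (fun s => in_force L L' m s && uses m s) [pos; neg])
    all_modalities.

Lemma requiresP uses L L' :
  requires uses L L' <-> exists m s, in_force L L' m s /\ uses m s.
Proof.
  unfold requires, is_true. rewrite existsb_exists. split.
  - intros (m & _ & H). apply existsb_exists in H. destruct H as (s & _ & H).
    apply andb_prop in H. now exists m, s.
  - intros (m & s & H1 & H2). exists m. split.
    + destruct m as [[[]|[]]|[[]|[]]]; cbn; tauto.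
    + apply existsb_exists. exists s. split.
      * destruct s; cbn; tauto.
      * now rewrite H1, H2.
Qed.

(** The residuated connectives belong to the signature exactly if they occur in
    some locality equation which is in force; by [requiresP], the
    quantification over [i] and [j] in [locality_eq] is then never vacuous for
    such an equation. *)
Definition local_signature (L : fmod -> bool) (L' : modality -> bool) :=
  Signature L (requires uses_imp L L') (requires uses_coimp L L').

Definition residuated {S} (A : algebra S) : Prop :=
  (forall i (a b c : A), c ⊑ imp i a b <-> a ⊓ c ⊑ b) /\
  (forall j (a b c : A), coimp j b a ⊑ c <-> b ⊑ a ⊔ c).

Definition local_unimodal_algebra (L : fmod -> bool) (L' : modality -> bool)
    (A : algebra (local_signature L L')) : Prop :=
  unimodal_algebra A /\ residuated A /\
  forall m, L' m -> forall s, locality_eq A m s.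

(** * Frames *)

(** Diagrammatic order: first [R1], then [R2]. *)
Definition rcomp {W} (R1 R2 : relation W) : relation W :=
  fun u w => exists v, R1 u v /\ R2 v w.

Notation "R1 ∘ R2" := (rcomp R1 R2) (at level 40, left associativity).

Definition generated_rel {W} (le R : relation W) (m : fmod) : relation W :=
  let ge := transp W le in
  match m with
  | box pos => le ∘ R ∘ le
  | dia pos => ge ∘ R ∘ ge
  | box neg => le ∘ R ∘ ge
  | dia neg => ge ∘ R ∘ le
  end.

(** The set of worlds may be empty, which accounts for the trivial algebra. *)
Record unimodal_frame (L : fmod -> bool) := UnimodalFrame {
  world :> Type;
  fle : relation world;
  frel : relation world;
  fle_order : order world fle;
  frel_inter : forall u v,
    frel u v <-> forall m, L m -> generated_rel fle frel m u v
}.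
Arguments fle {L} {_}.
Arguments frel {L} {_}.
Arguments fle_order {L} _.

Definition frame_locality {L} (F : unimodal_frame L) (m : modality) : Prop :=
  let le := @fle L F in
  let ge := transp F le in
  let R := @frel L F in
  match m with
  | fwd (dia pos) => inclusion F (ge ∘ R) (R ∘ ge)
  | fwd (dia neg) => inclusion F (ge ∘ R) (R ∘ le)
  | fwd (box pos) => inclusion F (le ∘ R) (R ∘ le)
  | fwd (box neg) => inclusion F (le ∘ R) (R ∘ ge)
  | bwd (dia pos) => inclusion F (R ∘ le) (le ∘ R)
  | bwd (dia neg) => inclusion F (R ∘ le) (ge ∘ R)
  | bwd (box pos) => inclusion F (R ∘ ge) (ge ∘ R)
  | bwd (box neg) => inclusion F (R ∘ ge) (le ∘ R)
  end.

Definition local_frame (L : fmod -> bool) (L' : modality -> bool)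
    (F : unimodal_frame L) : Prop :=
  forall m, L' m -> frame_locality F m.

(** * Complex algebras *)

Section ComplexAlgebra.
Variables (S : signature) (F : unimodal_frame (modals S)).
Implicit Types (u v w : F).

Definition is_upset (a : F -> Prop) : Prop := forall u v, fle u v -> a u -> a v.

Definition upset := {a : F -> Prop | is_upset a}.

Definition mem (u : F) (a : upset) : Prop := proj1_sig a u.

Let grel := generated_rel (@fle _ F) (@frel _ F).

Lemma cbot_upset : is_upset (fun _ => False).
Proof. now intros u v _. Qed.

Lemma ctop_upset : is_upset (fun _ => True).
Proof. now intros u v _. Qed.

Lemma cmeet_upset (a b : upset) : is_upset (fun u => mem u a /\ mem u b).
Proof.
  destruct a as [a Ha], b as [b Hb]. unfold mem; cbn. intros u v uv [H1 H2].
  split; [now apply (Ha u)|now apply (Hb u)].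
Qed.

Lemma cjoin_upset (a b : upset) : is_upset (fun u => mem u a \/ mem u b).
Proof.
  destruct a as [a Ha], b as [b Hb]. unfold mem; cbn. intros u v uv [H|H].
  - left; now apply (Ha u).
  - right; now apply (Hb u).
Qed.

Lemma cimp_upset (a b : upset) :
  is_upset (fun u => forall w, fle u w -> mem w a -> mem w b).
Proof.
  intros u v uv H w vw. apply H. now apply (ord_trans F _ (fle_order F) u v w).
Qed.

Lemma ccoimp_upset (b a : upset) :
  is_upset (fun u => exists w, fle w u /\ mem w b /\ ~ mem w a).
Proof.
  intros u v uv (w & wu & H). exists w. split; [|exact H].
  now apply (ord_trans F _ (fle_order F) w u v).
Qed.

Definition cmodal_pred (m : fmod) (a : upset) : F -> Prop :=
  match m with
  | box pos => fun u => forall v, grel (box pos) u v -> mem v a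
  | box neg => fun u => forall v, grel (box neg) u v -> ~ mem v a
  | dia pos => fun u => exists v, mem v a /\ grel (dia pos) u v
  | dia neg => fun u => exists v, ~ mem v a /\ grel (dia neg) u v
  end.

Lemma cmodal_upset (m : fmod) (a : upset) : is_upset (cmodal_pred m a).
Proof.
  pose proof (ord_trans F _ (fle_order F)) as T.
  assert (Hbox : forall (R : relation F) (P : F -> Prop),
    is_upset (fun u => forall v, (fle ∘ frel ∘ R) u v -> P v)).
  { intros R P u v uv H w (x & (y & vy & yx) & xw). apply H.
    exists x. split; [|exact xw]. exists y. split; [|exact yx].
    exact (T _ _ _ uv vy). }
  assert (Hdia : forall (R : relation F) (P : F -> Prop),
    is_upset (fun u => exists v, P v /\ (transp F fle ∘ frel ∘ R) u v)).
  { intros R P u v uv (w & Pw & x & (y & uy & yx) & xw).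
    exists w. split; [exact Pw|]. exists x. split; [|exact xw].
    exists y. split; [|exact yx]. exact (T _ _ _ uy uv). }
  destruct m as [[]|[]].
  - apply Hbox.
  - apply (Hbox _ (fun v => ~ mem v a)).
  - apply (Hdia _ (fun v => mem v a)).
  - apply (Hdia _ (fun v => ~ mem v a)).
Qed.

Definition complex_algebra : algebra S := {|
  carrier := upset;
  bot := exist _ _ cbot_upset;
  top := exist _ _ ctop_upset;
  meet := fun a b => exist _ _ (cmeet_upset a b);
  join := fun a b => exist _ _ (cjoin_upset a b);
  imp := fun _ a b => exist _ _ (cimp_upset a b);
  coimp := fun _ b a => exist _ _ (ccoimp_upset b a);
  modal := fun m _ a => exist _ _ (cmodal_upset m a)
|}.

End ComplexAlgebra.

Definition local_complex_algebra (L : fmod -> bool) (L' : modality -> bool)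
    (A : algebra (local_signature L L')) : Prop :=
  exists F : unimodal_frame L,
    local_frame L' F /\ A = complex_algebra (local_signature L L') F.

(** * Universal classes *)

Inductive term (S : signature) :=
| TVar (n : nat)
| TBot
| TTop
| TMeet (s t : term S)
| TJoin (s t : term S)
| TImp (i : has_imp S) (s t : term S)
| TCoimp (j : has_coimp S) (s t : term S)
| TModal (m : fmod) (h : modals S m) (t : term S).
Arguments TVar {S} n.
Arguments TBot {S}.
Arguments TTop {S}.
Arguments TModal {S} m h t.

Fixpoint eval {S} (A : algebra S) (v : nat -> A) (t : term S) : A :=
  match t with
  | TVar n => v n
  | TBot => bot
  | TTop => top
  | TMeet s t => eval A v s ⊓ eval A v t
  | TJoin s t => eval A v s ⊔ eval A v t
  | TImp i s t => imp i (eval A v s) (eval A v t)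
  | TCoimp j s t => coimp j (eval A v s) (eval A v t)
  | TModal m h t => modal A m h (eval A v t)
  end.

Inductive qf_formula (S : signature) :=
| QEq (s t : term S)
| QFalse
| QAnd (p q : qf_formula S)
| QOr (p q : qf_formula S)
| QImp (p q : qf_formula S).
Arguments QFalse {S}.

Fixpoint holds {S} (A : algebra S) (v : nat -> A) (p : qf_formula S) : Prop :=
  match p with
  | QEq s t => eval A v s = eval A v t
  | QFalse => False
  | QAnd p q => holds A v p /\ holds A v q
  | QOr p q => holds A v p \/ holds A v q
  | QImp p q => holds A v p -> holds A v q
  end.

(** Validity of the universal closure of [p]. *)
Definition valid {S} (A : algebra S) (p : qf_formula S) : Prop :=
  forall v : nat -> A, holds A v p.

Definition universal_class {S} (K : algebra S -> Prop) : Prop :=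
  exists T : qf_formula S -> Prop,
    forall A, K A <-> forall p, T p -> valid A p.

(** [K] is the least universal class containing [G]. *)
Definition generated_as_universal_class {S} (K G : algebra S -> Prop) : Prop :=
  universal_class K /\
  (forall A, G A -> K A) /\
  forall K', universal_class K' ->
    (forall A, G A -> K' A) -> forall A, K A -> K' A.

(* Main.v *)
(** Each forward modality preserves finite meets after dualizing its domain or
    its codomain, so that signs [r] (inner) and [s] (outer) turn the axioms and
    frame conditions into a few schemes indexed by [(s, r)]. An algebra embeds
    into the complex algebra of its frame of prime filters, whose relation is
    the intersection of the canonical relations of the modalities. To see that
    this relation generates the canonical relation of a modality from [u] to
    [v], pass to a pair [(u', v')] in that relation with [u'] maximal above [u]
    and then [v'] minimal below [v] (in the signed orders); the quasiequations
    say that such a pair lies in all the other canonical relations. The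
    locality conditions of the frame follow from the locality equations by
    prime filter separation. *)

From Stdlib Require Import Relations.
From Stdlib Require Import Classical ClassicalEpsilon.
From Stdlib Require Import FunctionalExtensionality PropExtensionality.
From mathcomp Require classical_sets.
Require Import Defs.

Set Implicit Arguments.
Set Bullet Behavior "Strict Subproofs".

(** * Subsets *)

Definition subset {T} (X Y : T -> Prop) : Prop := forall x, X x -> Y x.
Definition disjoint {T} (X Y : T -> Prop) : Prop := forall x, X x -> ~ Y x.

Notation "X ⊆ Y" := (subset X Y) (at level 70, no associativity).

Lemma subset_ext T (X Y : T -> Prop) : X ⊆ Y -> Y ⊆ X -> X = Y.
Proof.
  intros XY YX. apply functional_extensionality. intros x.
  apply propositional_extensionality. split; [apply XY|apply YX].
Qed.

Definition union {T} (X Y : T -> Prop) (x : T) : Prop := X x \/ Y x.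

Definition family_union {T} (C : (T -> Prop) -> Prop) (x : T) : Prop :=
  exists2 X, C X & X x.

Lemma family_union_empty T (C : (T -> Prop) -> Prop) (X : T -> Prop) :
  ~ (exists Z, C Z) -> union X (family_union C) = X.
Proof.
  intros C_empty. apply subset_ext; [|now left].
  intros x [Xx|[Z CZ _]]; [exact Xx|]. destruct C_empty. now exists Z.
Qed.

Lemma union_family_union T (C : (T -> Prop) -> Prop) (X : T -> Prop) :
  (exists Z, C Z) ->
  union X (family_union C) =
  family_union (fun Y => exists Z, C Z /\ Y = union X Z).
Proof.
  intros [Z0 CZ0]. apply subset_ext; intros x.
  - intros [Xx|[Z CZ Zx]].
    + exists (union X Z0); [now exists Z0|now left].
    + exists (union X Z); [now exists Z|now right].
  - intros [? (Z & CZ & ->) [Xx|Zx]]; [now left|].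
    right. now exists Z.
Qed.

Lemma Zorn_subset_above T (P : (T -> Prop) -> Prop) (X0 : T -> Prop) :
  P X0 ->
  (forall C, (exists X, C X) -> C ⊆ P ->
    (forall X Y, C X -> C Y -> X ⊆ Y \/ Y ⊆ X) -> P (family_union C)) ->
  exists M, P M /\ X0 ⊆ M /\ forall X, P X -> M ⊆ X -> X ⊆ M.
Proof.
  intros PX0 chain_closed.
  destruct (@classical_sets.Zorn_bigcup T (fun Z => P (union X0 Z)))
    as (M & PM & M_max).
  - intros C CP chain. change (P (union X0 (family_union C))).
    destruct (classic (exists Z, C Z)) as [C_inhabited|C_empty];
      [|now rewrite family_union_empty].
    rewrite union_family_union by exact C_inhabited. apply chain_closed.
    + destruct C_inhabited as [Z CZ]. now exists (union X0 Z), Z.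
    + intros ? (Z & CZ & ->). now apply CP.
    + intros ? ? (Z & CZ & ->) (Z' & CZ' & ->).
      destruct (chain Z Z' CZ CZ') as [ZZ'|Z'Z]; [left|right];
        intros x [Hx|Hx]; [now left|right|now left|right]; auto.
  - exists (union X0 M). split; [exact PM|]. split; [now left|].
    intros X PX MX x Xx. right. apply NNPP. intros nMx.
    apply (M_max X).
    + split; [intros y My; apply MX; now right|].
      intros XM. apply nMx, XM, Xx.
    + replace (union X0 X) with X; [exact PX|].
      apply subset_ext; [now right|].
      intros y [Hy|Hy]; [apply MX; now left|exact Hy].
Qed.

(** * Signed operations *)

Definition opp (s : sign) : sign := match s with pos => neg | neg => pos end.

Definition smul (s r : sign) : sign :=
  match s with pos => r | neg => opp r end.

(* [op s r] preserves finite meets from the [r]-signed to the [s]-signed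
   lattice, where sign [neg] means the order dual. *)
Definition op (s r : sign) : fmod :=
  match s, r with
  | pos, pos => box pos
  | pos, neg => box neg
  | neg, pos => dia neg
  | neg, neg => dia pos
  end.

Lemma oppK s : opp (opp s) = s.
Proof. now destruct s. Qed.

Lemma sign_eq_or_opp s t : t = s \/ t = opp s.
Proof. destruct s, t; cbn; tauto. Qed.

Lemma op_surj m : exists s r, m = op s r.
Proof.
  destruct m as [[]|[]];
    [exists pos, pos|exists pos, neg|exists neg, neg|exists neg, pos];
    reflexivity.
Qed.

Lemma adjointK m : adjoint (adjoint m) = m.
Proof. now destruct m as [[]|[]]. Qed.

Definition smeet {S} {A : algebra S} (s : sign) (a b : A) : A :=
  match s with pos => a ⊓ b | neg => a ⊔ b end.

Definition stop {S} {A : algebra S} (s : sign) : A :=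
  match s with pos => top | neg => bot end.

Definition sle {S} {A : algebra S} (s : sign) (a b : A) : Prop :=
  match s with pos => a ⊑ b | neg => b ⊑ a end.

Definition has_simp (S : signature) (s : sign) : bool :=
  match s with pos => has_imp S | neg => has_coimp S end.

Definition simp {S} {A : algebra S} (s : sign) :
    has_simp S s -> A -> A -> A :=
  match s with
  | pos => fun i a b => imp i a b
  | neg => fun j a b => coimp j b a
  end.

Notation sbot s := (stop (opp s)).
Notation "a ⊓[ s ] b" := (smeet s a b) (at level 40, left associativity).
Notation "a ⊔[ s ] b" := (smeet (opp s) a b)
  (at level 50, left associativity).
Notation "a ⊑[ s ] b" := (sle s a b) (at level 70, no associativity).

Lemma sle_opp {S} {A : algebra S} s (a b : A) : a ⊑[opp s] b <-> b ⊑[s] a.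
Proof. now destruct s. Qed.

Section SignedLattice.
Variables (S : signature) (A : algebra S).
Hypothesis lat : bounded_distributive_lattice A.
Implicit Types (s : sign) (a b c : A).

Lemma leq_join a b : a ⊑ b <-> a ⊔ b = b.
Proof.
  split; intros H.
  - rewrite <- H, (joinC lat), (meetC lat). apply (join_meet_absorb lat).
  - red. rewrite <- H. apply (meet_join_absorb lat).
Qed.

Lemma meet_idem a : a ⊓ a = a.
Proof.
  rewrite <- (join_meet_absorb lat a a) at 2. apply (meet_join_absorb lat).
Qed.

Lemma sle_meet s a b : a ⊑[s] b <-> a ⊓[s] b = a.
Proof.
  destruct s; [reflexivity|]. cbn. rewrite leq_join, (joinC lat). reflexivity.
Qed.

Lemma smeetA s a b c : a ⊓[s] (b ⊓[s] c) = a ⊓[s] b ⊓[s] c.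
Proof. destruct s; [apply (meetA lat)|apply (joinA lat)]. Qed.

Lemma smeetC s a b : a ⊓[s] b = b ⊓[s] a.
Proof. destruct s; [apply (meetC lat)|apply (joinC lat)]. Qed.

Lemma smeet_idem s a : a ⊓[s] a = a.
Proof. destruct s; [apply meet_idem|apply leq_join, meet_idem]. Qed.

Lemma sle_refl s a : a ⊑[s] a.
Proof. apply sle_meet, smeet_idem. Qed.

Lemma sle_trans s a b c : a ⊑[s] b -> b ⊑[s] c -> a ⊑[s] c.
Proof.
  rewrite !sle_meet. intros ab bc. now rewrite <- ab, <- smeetA, bc.
Qed.

Lemma sle_antisym s a b : a ⊑[s] b -> b ⊑[s] a -> a = b.
Proof. rewrite !sle_meet, (smeetC s b a). congruence. Qed.

Lemma smeet_l s a b : a ⊓[s] b ⊑[s] a.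
Proof. apply sle_meet. now rewrite smeetC, smeetA, smeet_idem. Qed.

Lemma smeet_r s a b : a ⊓[s] b ⊑[s] b.
Proof. rewrite smeetC. apply smeet_l. Qed.

Lemma smeet_glb s a b c : c ⊑[s] a -> c ⊑[s] b -> c ⊑[s] a ⊓[s] b.
Proof. rewrite !sle_meet. intros ca cb. now rewrite smeetA, ca. Qed.

Lemma smeet_mono s a a' b b' :
  a ⊑[s] a' -> b ⊑[s] b' -> a ⊓[s] b ⊑[s] a' ⊓[s] b'.
Proof.
  intros aa' bb'. apply smeet_glb.
  - now apply sle_trans with a; [apply smeet_l|].
  - now apply sle_trans with b; [apply smeet_r|].
Qed.

Lemma sjoin_l s a b : a ⊑[s] a ⊔[s] b.
Proof. apply sle_opp, smeet_l. Qed.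

Lemma sjoin_r s a b : b ⊑[s] a ⊔[s] b.
Proof. apply sle_opp, smeet_r. Qed.

Lemma sjoin_mono s a a' b b' :
  a ⊑[s] a' -> b ⊑[s] b' -> a ⊔[s] b ⊑[s] a' ⊔[s] b'.
Proof. intros aa' bb'. now apply sle_opp, smeet_mono; apply sle_opp. Qed.

Lemma sle_stop s a : a ⊑[s] stop s.
Proof.
  apply sle_meet. destruct s; [apply (meet_top lat)|apply (join_bot lat)].
Qed.

Lemma sbot_sle s a : sbot s ⊑[s] a.
Proof. apply sle_opp, sle_stop. Qed.

Lemma smeet_stop s a : stop s ⊓[s] a = a.
Proof. rewrite smeetC. apply sle_meet, sle_stop. Qed.

Lemma smeet_sbot s a : sbot s ⊓[s] a = sbot s.
Proof. apply sle_meet, sbot_sle. Qed.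

Lemma smeet_sjoin_distr s a b c :
  a ⊓[s] (b ⊔[s] c) = (a ⊓[s] b) ⊔[s] (a ⊓[s] c).
Proof.
  destruct s; cbn; [apply (meet_join_distr lat)|].
  rewrite (meet_join_distr lat), (meetC lat _ a), (meet_join_absorb lat).
  rewrite (meetC lat (a ⊔ b) c), (meet_join_distr lat), (joinA lat).
  rewrite (meetC lat c a), (join_meet_absorb lat). now rewrite (meetC lat c b).
Qed.

End SignedLattice.

Arguments sle_trans {S A} lat [s a b c].

(** * Signed axioms *)

(* The suffixes [inner], [outer] and [both] tell which of the signs of [op s r]
   are reversed in the other modality of the axiom. *)
Record signed_unimodal {S} (A : algebra S) : Prop := {
  su_lattice : bounded_distributive_lattice A;
  su_meet : forall s r (h : modals S (op s r)) a b,
    modal A _ h (a ⊓[r] b) = modal A _ h a ⊓[s] modal A _ h b;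
  su_top : forall s r (h : modals S (op s r)), modal A _ h (stop r) = stop s;
  su_inner : forall s r (h : modals S (op s r))
      (k : modals S (op s (opp r))) a b,
    modal A _ k a ⊓[s] modal A _ h (a ⊔[r] b) ⊑[s] modal A _ h b;
  su_outer : forall s r (h : modals S (op s r))
      (k : modals S (op (opp s) r)) a c,
    modal A _ k a ⊓[s] c ⊑[s] modal A _ h a -> c ⊑[s] modal A _ h a;
  su_both : forall s r (h : modals S (op s r))
      (k : modals S (op (opp s) (opp r))) a b c,
    modal A _ k b ⊓[s] c ⊑[s] modal A _ h a ->
    modal A _ h (a ⊔[r] b) ⊓[s] c ⊑[s] modal A _ h a
}.

Definition signed_residuated {S} (A : algebra S) : Prop :=
  forall s (i : has_simp S s) (a b c : A),
    c ⊑[s] simp s i a b <-> a ⊓[s] c ⊑[s] b.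

Definition fwd_local_both {S} (A : algebra S) (s r : sign) : Prop :=
  forall (h : modals S (op s r)) (k : modals S (op (opp s) (opp r))) a b,
    modal A _ h (a ⊔[r] b) ⊑[s] modal A _ h a ⊔[s] modal A _ k b.

Definition fwd_local_outer {S} (A : algebra S) (s r : sign) : Prop :=
  forall (h : modals S (op s r)) (k : modals S (op (opp s) r)) a,
    stop s ⊑[s] modal A _ h a ⊔[s] modal A _ k a.

Definition bwd_local_both {S} (A : algebra S) (s r : sign) : Prop :=
  forall (h : modals S (op s r)) (k : modals S (op (opp s) (opp r)))
      (i : has_simp S s) (j : has_simp S r) a b,
    simp s i (modal A _ k a) (modal A _ h b) ⊑[s] modal A _ h (simp r j a b).

Definition bwd_local_inner {S} (A : algebra S) (s r : sign) : Prop :=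
  forall (h : modals S (op s r)) (k : modals S (op s (opp r)))
      (j : has_simp S r) a,
    modal A _ k a ⊑[s] modal A _ h (simp r j a (sbot r)).

Record signed_local {S} (L' : modality -> bool) (A : algebra S) : Prop := {
  sl_fwd_both : forall s r,
    L' (fwd (op s r)) -> fwd_local_both A s r;
  sl_fwd_outer : forall s r,
    L' (fwd (op s r)) -> fwd_local_outer A s r;
  sl_bwd_both : forall s r,
    L' (bwd (adjoint (op s r))) -> bwd_local_both A s r;
  sl_bwd_inner : forall s r,
    L' (bwd (adjoint (op s r))) -> bwd_local_inner A s r
}.

Lemma signed_unimodalP S (A : algebra S) :
  unimodal_algebra A <-> signed_unimodal A.
Proof.
  split.
  - intros HA. pose proof (unimodal_modal HA) as HM.
    pose proof (modal_lattice HM) as lat. split.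
    + exact lat.
    + intros [] [] h;
        [apply (box_pos HM)|apply (box_neg HM)
        |apply (dia_neg HM)|apply (dia_pos HM)].
    + intros [] [] h;
        [apply (box_pos HM)|apply (box_neg HM)
        |apply (dia_neg HM)|apply (dia_pos HM)].
    + intros [] [] h k a b; cbn; [..|rewrite (joinC lat)|rewrite (joinC lat)];
        [apply (unimodal1 HA)|apply (unimodal2 HA)
        |apply (unimodal4 HA)|apply (unimodal3 HA)].
    + intros [] [] h k;
        [apply (unimodal5 HA)|apply (unimodal6 HA)
        |apply (unimodal8 HA)|apply (unimodal7 HA)].
    + intros [] [] h k;
        [apply (unimodal9 HA)|apply (unimodal10 HA)
        |apply (unimodal12 HA)|apply (unimodal11 HA)].
  - intros [lat meet top inner outer both]. split; [split|..].
    + exact lat.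
    + intros h; split; [apply (meet pos pos)|apply (top pos pos)].
    + intros h; split; [apply (meet neg neg)|apply (top neg neg)].
    + intros h; split; [apply (meet pos neg)|apply (top pos neg)].
    + intros h; split; [apply (meet neg pos)|apply (top neg pos)].
    + intros h k; apply (inner pos pos).
    + intros h k; apply (inner pos neg).
    + intros h k a b; rewrite (joinC lat); apply (inner neg neg).
    + intros h k a b; rewrite (joinC lat); apply (inner neg pos).
    + intros h k; apply (outer pos pos).
    + intros h k; apply (outer pos neg).
    + intros h k; apply (outer neg neg).
    + intros h k; apply (outer neg pos).
    + intros h k; apply (both pos pos).
    + intros h k; apply (both pos neg).
    + intros h k; apply (both neg neg).
    + intros h k; apply (both neg pos).
Qed.

Lemma signed_residuatedP S (A : algebra S) :
  residuated A <-> signed_residuated A.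
Proof.
  split.
  - intros [imp_res coimp_res] []; [apply imp_res|apply coimp_res].
  - intros res. split; [apply (res pos)|apply (res neg)].
Qed.

Section LocalityEquations.
Variables (S : signature) (A : algebra S).
Hypothesis lat : bounded_distributive_lattice A.

Lemma locality_eq_fwd_both s r :
  locality_eq A (fwd (op s r)) (smul s r) <-> fwd_local_both A s r.
Proof.
  destruct s, r; unfold fwd_local_both; cbn; try reflexivity;
    split; intros H h k a b.
  - rewrite (meetC lat), (joinC lat). apply H.
  - rewrite (meetC lat), (joinC lat). apply H.
  - rewrite (meetC lat (modal A _ h a)), (meetC lat a). apply H.
  - rewrite (meetC lat (modal A _ h a)), (meetC lat a). apply H.
Qed.

Lemma locality_eq_fwd_outer s r :
  locality_eq A (fwd (op s r)) (opp (smul s r)) <-> fwd_local_outer A s r.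
Proof.
  destruct s, r; unfold fwd_local_outer; cbn; try reflexivity;
    split; intros H h k a; rewrite (meetC lat); apply H.
Qed.

Lemma locality_eq_bwd_both s r :
  locality_eq A (bwd (adjoint (op s r))) (smul s r) <-> bwd_local_both A s r.
Proof.
  destruct s, r; unfold bwd_local_both; cbn;
    (split; [intros H h k i j|intros H h k]).
  - rewrite (proof_irrelevance _ i j). apply H.
  - intros i. apply H.
  - apply H.
  - intros i j. apply H.
  - apply H.
  - intros i j. apply H.
  - rewrite (proof_irrelevance _ i j). apply H.
  - intros i. apply H.
Qed.

Lemma locality_eq_bwd_inner s r :
  locality_eq A (bwd (adjoint (op s r))) (opp (smul s r)) <->
  bwd_local_inner A s r.
Proof.
  destruct s, r; unfold bwd_local_inner; cbn; split; intros H h k; apply H.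
Qed.

Lemma signed_localP (L' : modality -> bool) :
  (forall m, L' m -> forall t, locality_eq A m t) <-> signed_local L' A.
Proof.
  split.
  - intros H. split; intros s r Hm; specialize (H _ Hm).
    + apply locality_eq_fwd_both, H.
    + apply locality_eq_fwd_outer, H.
    + apply locality_eq_bwd_both, H.
    + apply locality_eq_bwd_inner, H.
  - intros loc [m|m] Hm t.
    + destruct (op_surj m) as (s & r & ->).
      destruct (sign_eq_or_opp (smul s r) t) as [-> | ->].
      * now apply locality_eq_fwd_both, (sl_fwd_both loc).
      * now apply locality_eq_fwd_outer, (sl_fwd_outer loc).
    + rewrite <- (adjointK m) in Hm |- *.
      destruct (op_surj (adjoint m)) as (s & r & E). rewrite E in *.
      destruct (sign_eq_or_opp (smul s r) t) as [-> | ->].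
      * now apply locality_eq_bwd_both, (sl_bwd_both loc).
      * now apply locality_eq_bwd_inner, (sl_bwd_inner loc).
Qed.

End LocalityEquations.

Lemma local_unimodal_signedP L L' (A : algebra (local_signature L L')) :
  local_unimodal_algebra A <->
  signed_unimodal A /\ signed_residuated A /\ signed_local L' A.
Proof.
  unfold local_unimodal_algebra.
  rewrite signed_unimodalP, signed_residuatedP.
  split; intros (HU & HR & HL);
    (split; [exact HU|split; [exact HR|]]);
    now apply (signed_localP (su_lattice HU)).
Qed.

(** * Universal classes *)

Lemma universal_class_iff S (K K' : algebra S -> Prop) :
  (forall A, K A <-> K' A) -> universal_class K' -> universal_class K.
Proof. intros E [T HT]. exists T. intros A. rewrite E. apply HT. Qed.

Lemma universal_class_and S (K K' : algebra S -> Prop) :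
  universal_class K -> universal_class K' ->
  universal_class (fun A => K A /\ K' A).
Proof.
  intros [T HT] [T' HT']. exists (fun p => T p \/ T' p).
  intros A. rewrite HT, HT'. firstorder.
Qed.

Definition models_theory {S} (K : algebra S -> Prop) (A : algebra S) : Prop :=
  forall p, (forall B, K B -> valid B p) -> valid A p.

Lemma universal_class_theory S (K : algebra S -> Prop) :
  (forall A, models_theory K A -> K A) -> universal_class K.
Proof.
  intros closed. exists (fun p => forall B, K B -> valid B p).
  intros A. split; [|apply closed]. intros HA p Hp. now apply Hp.
Qed.

Definition tsmeet {S} s (x y : term S) : term S :=
  match s with pos => TMeet x y | neg => TJoin x y end.

Definition tstop {S} s : term S :=
  match s with pos => TTop | neg => TBot end.

Definition tsimp {S} s : has_simp S s -> term S -> term S -> term S :=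
  match s with
  | pos => fun i x y => TImp i x y
  | neg => fun j x y => TCoimp j y x
  end.

Definition qsle {S} s (x y : term S) : qf_formula S :=
  match s with
  | pos => QEq (TMeet x y) x
  | neg => QEq (TMeet y x) y
  end.

Definition assign {T} (a b c : T) (n : nat) : T :=
  match n with 0 => a | 1 => b | _ => c end.

Section Axiomatization.
Variable S : signature.
Local Notation x := (@TVar S 0).
Local Notation y := (@TVar S 1).
Local Notation z := (@TVar S 2).

(* For concrete signs, the interpretation of a signed formula is convertible
   to the signed axiom. *)
Ltac from_theory HA p v ax :=
  let destruct_signs :=
    repeat match goal with s : sign |- _ => destruct s end in
  let H := fresh in
  assert (H : holds _ v p);
  [ apply HA; let B := fresh in let HB := fresh in let w := fresh in
    intros B HB w; pose proof (ax B HB w) as H; destruct_signs; exact H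
  | destruct_signs; exact H ].

Lemma lattice_universal :
  universal_class (@bounded_distributive_lattice S).
Proof.
  apply universal_class_theory. intros A HA.
  split.
  - intros a b c.
    from_theory HA (QEq (TMeet x (TMeet y z)) (TMeet (TMeet x y) z))
      (assign a b c) (fun B HB w => @meetA S B HB (w 0) (w 1) (w 2)).
  - intros a b.
    from_theory HA (QEq (TMeet x y) (TMeet y x)) (assign a b a)
      (fun B HB w => @meetC S B HB (w 0) (w 1)).
  - intros a b c.
    from_theory HA (QEq (TJoin x (TJoin y z)) (TJoin (TJoin x y) z))
      (assign a b c) (fun B HB w => @joinA S B HB (w 0) (w 1) (w 2)).
  - intros a b.
    from_theory HA (QEq (TJoin x y) (TJoin y x)) (assign a b a)
      (fun B HB w => @joinC S B HB (w 0) (w 1)).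
  - intros a b.
    from_theory HA (QEq (TMeet x (TJoin x y)) x) (assign a b a)
      (fun B HB w => @meet_join_absorb S B HB (w 0) (w 1)).
  - intros a b.
    from_theory HA (QEq (TJoin x (TMeet x y)) x) (assign a b a)
      (fun B HB w => @join_meet_absorb S B HB (w 0) (w 1)).
  - intros a b c.
    from_theory HA (QEq (TMeet x (TJoin y z)) (TJoin (TMeet x y) (TMeet x z)))
      (assign a b c) (fun B HB w => @meet_join_distr S B HB (w 0) (w 1) (w 2)).
  - intros a.
    from_theory HA (QEq (TJoin x TBot) x) (assign a a a)
      (fun B HB w => @join_bot S B HB (w 0)).
  - intros a.
    from_theory HA (QEq (TMeet x TTop) x) (assign a a a)
      (fun B HB w => @meet_top S B HB (w 0)).
Qed.

Lemma signed_unimodal_universal : universal_class (@signed_unimodal S).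
Proof.
  apply universal_class_theory. intros A HA. split.
  - destruct lattice_universal as [T HT]. apply HT. intros p Tp.
    apply HA. intros B HB. now apply HT, Tp; apply su_lattice.
  - intros s r h a b. from_theory HA
      (QEq (TModal _ h (tsmeet r x y))
        (tsmeet s (TModal _ h x) (TModal _ h y)))
      (assign a b a) (fun B HB w => @su_meet S B HB s r h (w 0) (w 1)).
  - intros s r h. from_theory HA
      (QEq (TModal _ h (tstop r)) (tstop s))
      (fun _ : nat => @top S A)
      (fun B HB (_ : nat -> carrier B) => @su_top S B HB s r h).
  - intros s r h k a b. from_theory HA
      (qsle s (tsmeet s (TModal _ k x) (TModal _ h (tsmeet (opp r) x y)))
        (TModal _ h y))
      (assign a b a) (fun B HB w => @su_inner S B HB s r h k (w 0) (w 1)).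
  - intros s r h k a c. from_theory HA
      (QImp (qsle s (tsmeet s (TModal _ k x) z) (TModal _ h x))
        (qsle s z (TModal _ h x)))
      (assign a a c) (fun B HB w => @su_outer S B HB s r h k (w 0) (w 2)).
  - intros s r h k a b c. from_theory HA
      (QImp (qsle s (tsmeet s (TModal _ k y) z) (TModal _ h x))
        (qsle s (tsmeet s (TModal _ h (tsmeet (opp r) x y)) z) (TModal _ h x)))
      (assign a b c) (fun B HB w => @su_both S B HB s r h k (w 0) (w 1) (w 2)).
Qed.

Lemma signed_residuated_universal : universal_class (@signed_residuated S).
Proof.
  apply universal_class_theory. intros A HA s i a b c. from_theory HA
    (QAnd (QImp (qsle s z (tsimp s i x y)) (qsle s (tsmeet s x z) y))
      (QImp (qsle s (tsmeet s x z) y) (qsle s z (tsimp s i x y))))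
    (assign a b c)
    (fun B (HB : @signed_residuated S B) w => HB s i (w 0) (w 1) (w 2)).
Qed.

Lemma signed_local_universal (L' : modality -> bool) :
  universal_class (@signed_local S L').
Proof.
  apply universal_class_theory. intros A HA. split.
  - intros s r Hm h k a b. from_theory HA
      (qsle s (TModal _ h (tsmeet (opp r) x y))
        (tsmeet (opp s) (TModal _ h x) (TModal _ k y)))
      (assign a b a)
      (fun B HB w => @sl_fwd_both S L' B HB s r Hm h k (w 0) (w 1)).
  - intros s r Hm h k a. from_theory HA
      (qsle s (tstop s) (tsmeet (opp s) (TModal _ h x) (TModal _ k x)))
      (assign a a a)
      (fun B HB w => @sl_fwd_outer S L' B HB s r Hm h k (w 0)).
  - intros s r Hm h k i j a b. from_theory HA
      (qsle s (tsimp s i (TModal _ k x) (TModal _ h y))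
        (TModal _ h (tsimp r j x y)))
      (assign a b a)
      (fun B HB w => @sl_bwd_both S L' B HB s r Hm h k i j (w 0) (w 1)).
  - intros s r Hm h k j a. from_theory HA
      (qsle s (TModal _ k x) (TModal _ h (tsimp r j x (tstop (opp r)))))
      (assign a a a)
      (fun B HB w => @sl_bwd_inner S L' B HB s r Hm h k j (w 0)).
Qed.

End Axiomatization.

Lemma local_unimodal_universal L L' :
  universal_class (@local_unimodal_algebra L L').
Proof.
  apply universal_class_iff with (1 := @local_unimodal_signedP L L').
  repeat apply universal_class_and.
  - apply signed_unimodal_universal.
  - apply signed_residuated_universal.
  - apply signed_local_universal.
Qed.

Record embedding {S} (A B : algebra S) (e : A -> B) : Prop := {
  emb_inj : forall a b, e a = e b -> a = b;
  emb_bot : e bot = bot;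
  emb_top : e top = top;
  emb_meet : forall a b, e (a ⊓ b) = e a ⊓ e b;
  emb_join : forall a b, e (a ⊔ b) = e a ⊔ e b;
  emb_imp : forall i a b, e (imp i a b) = imp i (e a) (e b);
  emb_coimp : forall j a b, e (coimp j a b) = coimp j (e a) (e b);
  emb_modal : forall m h a, e (modal A m h a) = modal B m h (e a)
}.

Section Embedding.
Variables (S : signature) (A B : algebra S) (e : A -> B).
Hypothesis He : embedding A B e.

Lemma eval_embedding v t : eval B (fun n => e (v n)) t = e (eval A v t).
Proof.
  induction t as [n| | |t1 IH1 t2 IH2|t1 IH1 t2 IH2|i t1 IH1 t2 IH2
    |j t1 IH1 t2 IH2|m h t IH]; cbn [eval]; rewrite ?IH1, ?IH2, ?IH;
    symmetry; [reflexivity|apply He..].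
Qed.

Lemma holds_embedding v p : holds B (fun n => e (v n)) p <-> holds A v p.
Proof.
  induction p as [t1 t2| |p IHp q IHq|p IHp q IHq|p IHp q IHq]; cbn [holds];
    try tauto.
  rewrite !eval_embedding. split; [apply (emb_inj He)|congruence].
Qed.

Lemma universal_class_embedding K : universal_class K -> K B -> K A.
Proof.
  intros [T HT] HB. apply HT. intros p Tp v. apply holds_embedding.
  now apply HT.
Qed.

End Embedding.

(** * Prime filters *)

Definition prime {S} {A : algebra S} (P : A -> Prop) : Prop :=
  P top /\ ~ P bot /\
  (forall a b, P (a ⊓ b) <-> P a /\ P b) /\
  (forall a b, P (a ⊔ b) <-> P a \/ P b).

Record point {S} (A : algebra S) := Point {
  pmem :> A -> Prop;
  pprime : prime pmem
}.

Definition smem {S} {A : algebra S} (s : sign) (u : point A) (a : A) : Prop :=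
  match s with pos => u a | neg => ~ u a end.

Definition ple {S} {A : algebra S} (s : sign) (u v : point A) : Prop :=
  smem s u ⊆ smem s v.

Record sfilter {S} {A : algebra S} (s : sign) (F : A -> Prop) : Prop := {
  sfilter_top : F (stop s);
  sfilter_meet : forall a b, F a -> F b -> F (a ⊓[s] b);
  sfilter_up : forall a b, a ⊑[s] b -> F a -> F b
}.

Definition filter_join {S} {A : algebra S} (s : sign) (F G : A -> Prop)
    (c : A) : Prop :=
  exists a b, F a /\ G b /\ a ⊓[s] b ⊑[s] c.

Section Points.
Variables (S : signature) (A : algebra S).
Implicit Types (s : sign) (a b c d : A) (u v w : point A) (F G I M : A -> Prop).

Lemma smem_opp s u a : smem (opp s) u a <-> ~ smem s u a.
Proof. destruct s; cbn; [tauto|split; [tauto|apply NNPP]]. Qed.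

Lemma smem_meet s u a b : smem s u (a ⊓[s] b) <-> smem s u a /\ smem s u b.
Proof.
  destruct (pprime u) as (_ & _ & Hm & Hj).
  destruct s; cbn; [apply Hm|rewrite Hj; tauto].
Qed.

Lemma smem_join s u a b : smem s u (a ⊔[s] b) <-> smem s u a \/ smem s u b.
Proof.
  destruct (pprime u) as (_ & _ & Hm & Hj).
  destruct s; cbn; [apply Hj|rewrite Hm].
  split; [apply not_and_or|tauto].
Qed.

Lemma smem_top s u : smem s u (stop s).
Proof. destruct (pprime u) as (Ht & Hb & _), s; cbn; tauto. Qed.

Lemma smem_bot s u : ~ smem s u (sbot s).
Proof. destruct (pprime u) as (Ht & Hb & _), s; cbn; tauto. Qed.

Lemma ple_refl s u : ple s u u.
Proof. now intros a. Qed.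

Lemma ple_trans s u v w : ple s u v -> ple s v w -> ple s u w.
Proof. intros uv vw a Ha. now apply vw, uv. Qed.

Lemma ple_opp s u v : ple (opp s) u v <-> ple s v u.
Proof.
  unfold ple, subset. split; intros H a; specialize (H a);
    rewrite !smem_opp in *; [|tauto].
  intros Hv. apply NNPP. tauto.
Qed.

Lemma ple_antisym s u v : ple s u v -> ple s v u -> u = v.
Proof.
  intros uv vu.
  assert (E : pmem u = pmem v).
  { apply subset_ext; intros a Ha; specialize (uv a); specialize (vu a);
      destruct s; cbn in *; apply NNPP; tauto. }
  destruct u as [P HP], v as [Q HQ]. cbn in E. subst Q.
  now rewrite (proof_irrelevance _ HP HQ).
Qed.

Hypothesis lat : bounded_distributive_lattice A.

Lemma smem_le s u a b : a ⊑[s] b -> smem s u a -> smem s u b.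
Proof.
  intros H Hu. apply (sle_meet lat) in H. rewrite <- H in Hu.
  now apply smem_meet in Hu.
Qed.

Lemma smem_sfilter s u : sfilter s (smem s u).
Proof.
  split.
  - apply smem_top.
  - intros a b Ha Hb. now apply smem_meet.
  - intros a b. apply smem_le.
Qed.

Lemma principal_sfilter s a : sfilter s (sle s a).
Proof.
  split.
  - apply (sle_stop lat).
  - intros b c. apply (smeet_glb lat).
  - intros b c bc ab. exact (sle_trans lat ab bc).
Qed.

Lemma filter_join_sfilter s F G :
  sfilter s F -> sfilter s G -> sfilter s (filter_join s F G).
Proof.
  intros HF HG. split.
  - exists (stop s), (stop s). split; [apply HF|]. split; [apply HG|].
    apply (sle_stop lat).
  - intros c c' (a & b & Fa & Gb & abc) (a' & b' & Fa' & Gb' & abc').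
    exists (a ⊓[s] a'), (b ⊓[s] b').
    split; [now apply HF|]. split; [now apply HG|].
    apply (smeet_glb lat).
    + refine (sle_trans lat _ abc).
      apply (smeet_mono lat); apply (smeet_l lat).
    + refine (sle_trans lat _ abc').
      apply (smeet_mono lat); apply (smeet_r lat).
  - intros c d cd (a & b & Fa & Gb & abc). exists a, b.
    split; [exact Fa|]. split; [exact Gb|]. exact (sle_trans lat abc cd).
Qed.

Lemma filter_join_l s F G : sfilter s G -> F ⊆ filter_join s F G.
Proof.
  intros HG a Fa. exists a, (stop s).
  split; [exact Fa|]. split; [apply HG|apply (smeet_l lat)].
Qed.

Lemma filter_join_r s F G : sfilter s F -> G ⊆ filter_join s F G.
Proof.
  intros HF b Gb. exists (stop s), b.
  split; [apply HF|]. split; [exact Gb|apply (smeet_r lat)].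
Qed.

Lemma prime_sfilter_point s F :
  sfilter s F -> ~ F (sbot s) ->
  (forall a b, F (a ⊔[s] b) -> F a \/ F b) ->
  exists u : point A, forall a, smem s u a <-> F a.
Proof.
  intros HF Fbot Fjoin.
  assert (Fmeet_iff : forall a b, F (a ⊓[s] b) <-> F a /\ F b).
  { split; [|now intros []; apply HF].
    split; (eapply (sfilter_up HF); [|eassumption]);
      [apply (smeet_l lat)|apply (smeet_r lat)]. }
  assert (Fjoin_iff : forall a b, F (a ⊔[s] b) <-> F a \/ F b).
  { split; [apply Fjoin|]. intros [H|H]; (eapply (sfilter_up HF); [|exact H]);
      [apply (sjoin_l lat)|apply (sjoin_r lat)]. }
  pose proof (sfilter_top HF) as Ftop. destruct s.
  - assert (HP : prime F) by now split; [|split; [|split]].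
    now exists (Point HP).
  - assert (HP : prime (fun a => ~ F a)).
    { split; [exact Fbot|]. split; [now intros H|]. split; intros a b.
      - rewrite (Fjoin_iff a b). tauto.
      - rewrite (Fmeet_iff a b). split; [apply not_and_or|tauto]. }
    exists (Point HP). intros a. cbn. split; [apply NNPP|tauto].
Qed.

Lemma chain_family_union_sfilter s (C : (A -> Prop) -> Prop) :
  (exists F, C F) -> C ⊆ sfilter s ->
  (forall F G, C F -> C G -> F ⊆ G \/ G ⊆ F) -> sfilter s (family_union C).
Proof.
  intros [F0 CF0] C_filters chain. split.
  - exists F0; [exact CF0|apply (C_filters F0 CF0)].
  - intros a b [F CF Fa] [G CG Gb].
    destruct (chain F G CF CG) as [FG|GF].
    + exists G; [exact CG|].
      apply (C_filters G CG); [now apply FG|exact Gb].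
    + exists F; [exact CF|].
      apply (C_filters F CF); [exact Fa|now apply GF].
  - intros a b ab [F CF Fa]. exists F; [exact CF|].
    exact (sfilter_up (C_filters F CF) a b ab Fa).
Qed.

Definition maximal_disjoint s I M : Prop :=
  sfilter s M /\ disjoint M I /\
  forall G, sfilter s G -> disjoint G I -> M ⊆ G -> G ⊆ M.

Lemma maximal_disjoint_sfilter s F I :
  sfilter s F -> disjoint F I -> exists M, maximal_disjoint s I M /\ F ⊆ M.
Proof.
  intros HF FI.
  destruct (@Zorn_subset_above A (fun G => sfilter s G /\ disjoint G I) F)
    as (M & [HM MI] & FM & M_max).
  - now split.
  - intros C HC CP chain. split.
    + apply chain_family_union_sfilter; [exact HC| |exact chain].
      intros G CG. apply (CP G CG).
    + intros a [G CG Ga]. now apply (CP G CG).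
  - exists M. split; [|exact FM]. split; [exact HM|]. split; [exact MI|].
    intros G HG GI. now apply M_max.
Qed.

Lemma maximal_disjoint_meets s I M :
  sfilter (opp s) I -> maximal_disjoint s I M ->
  forall a, ~ M a -> exists c, M c /\ I (c ⊓[s] a).
Proof.
  intros HI (HM & MI & M_max) a nMa. apply NNPP. intros no. apply nMa.
  apply (M_max (filter_join s M (sle s a))).
  - apply (filter_join_sfilter HM), principal_sfilter.
  - intros d (c & a' & Mc & aa' & cad) Id. apply no. exists c.
    split; [exact Mc|]. apply (sfilter_up HI d); [|exact Id].
    apply sle_opp. apply (sle_trans lat) with (c ⊓[s] a'); [|exact cad].
    apply (smeet_mono lat); [apply (sle_refl lat)|exact aa'].
  - apply filter_join_l, principal_sfilter.
  - apply filter_join_r; [exact HM|apply (sle_refl lat)].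
Qed.

Lemma maximal_disjoint_prime s I M :
  sfilter (opp s) I -> maximal_disjoint s I M ->
  forall a b, M (a ⊔[s] b) -> M a \/ M b.
Proof.
  intros HI HM a b Mab. apply NNPP. intros no.
  apply not_or_and in no as [na nb].
  destruct (maximal_disjoint_meets HI HM a na) as (c & Mc & Ica).
  destruct (maximal_disjoint_meets HI HM b nb) as (d & Md & Idb).
  destruct HM as (HM & MI & _).
  apply (MI ((c ⊓[s] d) ⊓[s] (a ⊔[s] b))).
  - apply HM; [now apply HM|exact Mab].
  - apply (sfilter_up HI ((c ⊓[s] a) ⊔[s] (d ⊓[s] b))).
    + apply sle_opp. rewrite (smeet_sjoin_distr lat).
      apply (sjoin_mono lat); apply (smeet_mono lat);
        [apply (smeet_l lat)|apply (sle_refl lat)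
        |apply (smeet_r lat)|apply (sle_refl lat)].
    + now apply HI.
Qed.

(* The last clause, the maximality of [u], is what makes the canonical
   relations generated by their intersection. *)
Theorem prime_separation s F I :
  sfilter s F -> sfilter (opp s) I -> disjoint F I ->
  exists u : point A, F ⊆ smem s u /\ disjoint (smem s u) I /\
    forall a, ~ smem s u a -> exists c, smem s u c /\ I (c ⊓[s] a).
Proof.
  intros HF HI FI.
  destruct (maximal_disjoint_sfilter HF FI) as (M & HM & FM).
  pose proof HM as (M_filter & MI & _).
  destruct (prime_sfilter_point M_filter) as [u Hu].
  - intros Mbot. exact (MI _ Mbot (sfilter_top HI)).
  - exact (maximal_disjoint_prime HI HM).
  - exists u. split; [|split].
    + intros a Fa. now apply Hu, FM.
    + intros a Ha. now apply MI, Hu.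
    + intros a. rewrite Hu. intros nMa.
      destruct (maximal_disjoint_meets HI HM a nMa) as (c & Mc & Ic).
      exists c. now rewrite Hu.
Qed.

Lemma sle_points s a b : (forall u, smem s u a -> smem s u b) -> a ⊑[s] b.
Proof.
  intros H. apply NNPP. intros nab.
  destruct (@prime_separation s (sle s a) (sle (opp s) b)) as (u & Ha & Hb & _).
  - apply principal_sfilter.
  - apply principal_sfilter.
  - intros c ac bc. rewrite sle_opp in bc. exact (nab (sle_trans lat ac bc)).
  - apply (Hb b); [|apply (sle_refl lat)]. apply H, Ha, (sle_refl lat).
Qed.

End Points.

Arguments smem_le {S A} lat [s] u [a b].

(* By [sle_points], an inequality of bounded distributive lattices amounts to a
   propositional entailment at every point. *)
Ltac lattice lat :=
  apply (sle_points lat);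
  let u := fresh "u" in
  intros u;
  repeat match goal with
    H : sle _ _ _ |- _ =>
      pose proof (smem_le lat u H); clear H
  end;
  rewrite ?smem_meet, ?smem_join in *; tauto.

(** * Complex algebras *)

Definition srel {W} (s : sign) (le : relation W) : relation W :=
  match s with pos => le | neg => transp W le end.

Lemma generated_relE W (le R : relation W) s r :
  generated_rel le R (op s r) = srel s le ∘ R ∘ srel r le.
Proof. now destruct s, r. Qed.

Lemma frame_locality_fwd L (F : unimodal_frame L) s r :
  frame_locality F (fwd (op s r)) =
  inclusion F (srel s fle ∘ frel) (frel ∘ srel r fle).
Proof. now destruct s, r. Qed.

Lemma frame_locality_bwd L (F : unimodal_frame L) s r :
  frame_locality F (bwd (adjoint (op s r))) =
  inclusion F (frel ∘ srel r fle) (srel s fle ∘ frel).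
Proof. now destruct s, r. Qed.

Section ComplexAlgebra.
Variables (S : signature) (F : unimodal_frame (modals S)).
Let C := complex_algebra S F.
Implicit Types (s r : sign) (u v w x y z : F) (a b c : C).

Lemma complex_ext a b : (forall u, mem u a <-> mem u b) -> a = b.
Proof.
  destruct a as [P HP], b as [Q HQ]. unfold mem; cbn. intros E.
  assert (P = Q) as <- by now apply subset_ext; intros u; apply E.
  now rewrite (proof_irrelevance _ HP HQ).
Qed.

Lemma complex_lattice : bounded_distributive_lattice C.
Proof.
  split; intros; apply complex_ext; intros u; unfold mem; cbn;
    unfold mem; cbn; tauto.
Qed.

Lemma world_prime u : prime (fun a : C => mem u a).
Proof. unfold prime, mem; cbn. tauto. Qed.

Definition world_point u : point C := Point (world_prime u).

Local Notation wmem s u := (smem s (world_point u)).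

Lemma complex_sext s a b : (forall u, wmem s u a <-> wmem s u b) -> a = b.
Proof.
  intros E. apply complex_ext. intros u. specialize (E u).
  destruct s; cbn in E; [exact E|].
  split; intros Hu; apply NNPP; tauto.
Qed.

Lemma complex_sle s a b :
  a ⊑[s] b <-> forall u, wmem s u a -> wmem s u b.
Proof.
  split.
  - intros H u. now apply (smem_le complex_lattice).
  - intros H. apply (sle_meet complex_lattice), (complex_sext s).
    intros u. rewrite smem_meet. specialize (H u). tauto.
Qed.

Lemma srel_refl s u : srel s fle u u.
Proof. destruct s; apply (ord_refl _ _ (fle_order F)). Qed.

Lemma srel_trans s u v w : srel s fle u v -> srel s fle v w -> srel s fle u w.
Proof.
  pose proof (ord_trans _ _ (fle_order F)) as trans.
  destruct s; cbn; intros uv vw; [exact (trans _ _ _ uv vw)|].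
  exact (trans _ _ _ vw uv).
Qed.

Lemma wmem_srel s u v a : srel s fle u v -> wmem s u a -> wmem s v a.
Proof.
  destruct s; cbn; intros uv.
  - apply (proj2_sig a _ _ uv).
  - intros Hu Hv. apply Hu. exact (proj2_sig a _ _ uv Hv).
Qed.

Arguments wmem_srel [s u v a].

Lemma wmem_modal_generated s r (h : modals S (op s r)) a u :
  wmem s u (modal C _ h a) <->
  forall v, generated_rel fle frel (op s r) u v -> wmem r v a.
Proof.
  destruct s, r; cbn; unfold mem; cbn; try reflexivity; split.
  - intros H v uv. apply NNPP. intros Hv. apply H. now exists v.
  - intros H (v & Hv & uv). exact (Hv (H v uv)).
  - intros H v uv Hv. apply H. now exists v.
  - intros H (v & Hv & uv). exact (H v uv Hv).
Qed.

Lemma wmem_modal s r (h : modals S (op s r)) a u :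
  wmem s u (modal C _ h a) <->
  forall x y, srel s fle u x -> frel x y -> wmem r y a.
Proof.
  rewrite wmem_modal_generated, generated_relE. split.
  - intros H x y ux xy. apply H. exists y. split; [now exists x|].
    apply srel_refl.
  - intros H v (y & (x & ux & xy) & yv). apply (wmem_srel yv). eauto.
Qed.

Lemma wmem_modal_frel s r (h : modals S (op s r)) a u v :
  frel u v -> wmem s u (modal C _ h a) -> wmem r v a.
Proof.
  intros uv Hu. rewrite wmem_modal in Hu.
  exact (Hu u v (srel_refl _ _) uv).
Qed.

Arguments wmem_modal_frel [s r] h [a u v].

Lemma wmem_modal_opp s r (k : modals S (op (opp s) r)) a u v :
  frel u v -> ~ wmem r v a -> wmem s u (modal C _ k a).
Proof.
  intros uv Hv. apply NNPP. rewrite <- smem_opp. intros Hu.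
  exact (Hv (wmem_modal_frel k uv Hu)).
Qed.

Arguments wmem_modal_opp [s r] k [a u v].

Lemma wmem_simp s (i : has_simp S s) a b u :
  wmem s u (simp s i a b) <->
  forall w, srel s fle u w -> wmem s w a -> wmem s w b.
Proof.
  destruct s; cbn; unfold mem; cbn; unfold mem; [reflexivity|]. split.
  - intros H w wu Ha Hb. apply H. exists w. tauto.
  - intros H (w & wu & Hb & Ha). exact (H w wu Ha Hb).
Qed.

Theorem complex_signed_unimodal : signed_unimodal C.
Proof.
  split.
  - apply complex_lattice.
  - intros s r h a b. apply (complex_sext s). intros u.
    rewrite smem_meet, !wmem_modal. setoid_rewrite smem_meet. firstorder.
  - intros s r h. apply (complex_sext s). intros u.
    rewrite wmem_modal. split; intros; apply smem_top.
  - intros s r h k a b. apply complex_sle. intros u.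
    rewrite smem_meet, !wmem_modal. intros [Ha Hab] x y ux xy.
    specialize (Ha x y ux xy). specialize (Hab x y ux xy).
    rewrite smem_opp in Ha. rewrite smem_join in Hab. tauto.
  - intros s r h k a c H. rewrite complex_sle in H. apply complex_sle.
    intros u Hc. apply wmem_modal. intros x y ux xy.
    apply NNPP. intros Hy. apply Hy. apply (wmem_modal_frel h xy).
    apply H, smem_meet. split; [exact (wmem_modal_opp k xy Hy)|].
    exact (wmem_srel ux Hc).
  - intros s r h k a b c H. rewrite complex_sle in H. apply complex_sle.
    intros u. rewrite smem_meet. intros [Hab Hc]. apply wmem_modal.
    intros x y ux xy. rewrite wmem_modal in Hab.
    specialize (Hab x y ux xy). apply smem_join in Hab as [Ha|Hb]; [exact Ha|].
    apply (wmem_modal_frel h xy), H, smem_meet.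
    split; [|exact (wmem_srel ux Hc)].
    apply (wmem_modal_opp k xy). now rewrite smem_opp.
Qed.

Lemma complex_signed_residuated : signed_residuated C.
Proof.
  intros s i a b c. rewrite !complex_sle. split; intros H u.
  - rewrite smem_meet. intros [Ha Hc]. specialize (H u Hc).
    rewrite wmem_simp in H. exact (H u (srel_refl _ _) Ha).
  - intros Hc. apply wmem_simp. intros w uw Ha.
    apply H, smem_meet. split; [exact Ha|exact (wmem_srel uw Hc)].
Qed.

Lemma complex_fwd_local_both s r :
  inclusion F (srel s fle ∘ frel) (frel ∘ srel r fle) ->
  fwd_local_both C s r.
Proof.
  intros loc h k a b. apply complex_sle. intros u Hab. apply smem_join.
  apply NNPP. intros no. apply not_or_and in no as [na nb]. apply na.
  apply wmem_modal. intros x y ux xy.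
  destruct (loc u y) as (z & uz & zy); [now exists x|].
  apply (wmem_srel zy).
  apply (wmem_modal_frel h uz), smem_join in Hab as [Ha|Hb]; [exact Ha|].
  destruct nb. apply (wmem_modal_opp k uz). now rewrite smem_opp.
Qed.

Lemma complex_fwd_local_outer s r :
  inclusion F (srel s fle ∘ frel) (frel ∘ srel r fle) ->
  fwd_local_outer C s r.
Proof.
  intros loc h k a. apply complex_sle. intros u _. apply smem_join.
  apply NNPP. intros no. apply not_or_and in no as [na nb]. apply na.
  apply wmem_modal. intros x y ux xy.
  destruct (loc u y) as (z & uz & zy); [now exists x|].
  apply (wmem_srel zy). apply NNPP. intros Hz.
  exact (nb (wmem_modal_opp k uz Hz)).
Qed.

Lemma complex_bwd_local_both s r :
  inclusion F (frel ∘ srel r fle) (srel s fle ∘ frel) ->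
  bwd_local_both C s r.
Proof.
  intros loc h k i j a b. apply complex_sle. intros u Hu.
  apply wmem_modal. intros x y ux xy. apply wmem_simp. intros z yz Ha.
  destruct (loc x z) as (x' & xx' & x'z); [now exists y|].
  apply (wmem_modal_frel h x'z).
  rewrite wmem_simp in Hu. apply Hu; [now apply srel_trans with x|].
  apply (wmem_modal_opp k x'z). now rewrite smem_opp.
Qed.

Lemma complex_bwd_local_inner s r :
  inclusion F (frel ∘ srel r fle) (srel s fle ∘ frel) ->
  bwd_local_inner C s r.
Proof.
  intros loc h k j a. apply complex_sle. intros u Hu.
  apply wmem_modal. intros x y ux xy. apply wmem_simp. intros z yz Ha.
  destruct (loc x z) as (x' & xx' & x'z); [now exists y|].
  rewrite wmem_modal in Hu.
  enough (Hz : wmem (opp r) z a) by (apply smem_opp in Hz; contradiction).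
  apply (Hu x' z); [now apply srel_trans with x|exact x'z].
Qed.

Lemma complex_signed_local L' : local_frame L' F -> signed_local L' C.
Proof.
  intros loc. split; intros s r Hm; apply loc in Hm;
    rewrite ?frame_locality_fwd, ?frame_locality_bwd in Hm.
  - now apply complex_fwd_local_both.
  - now apply complex_fwd_local_outer.
  - now apply complex_bwd_local_both.
  - now apply complex_bwd_local_inner.
Qed.

End ComplexAlgebra.

Lemma complex_local_unimodal L L' (A : algebra (local_signature L L')) :
  local_complex_algebra A -> local_unimodal_algebra A.
Proof.
  intros (F & HF & ->). apply local_unimodal_signedP.
  split; [apply complex_signed_unimodal|].
  split; [apply complex_signed_residuated|].
  now apply (@complex_signed_local (local_signature L L') F).
Qed.

(** * Canonical relations *)

Section CanonicalRelation.
Variables (S : signature) (A : algebra S).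
Hypothesis lat : bounded_distributive_lattice A.
Variable f : sign -> sign -> A -> A.
Hypothesis f_top : forall s r, f s r (stop r) = stop s.
Hypothesis f_meet :
  forall s r a b, f s r (a ⊓[r] b) = f s r a ⊓[s] f s r b.
Implicit Types (s r : sign) (a b c d : A) (u v : point A).

Definition modal_preimage s r u : A -> Prop := fun a => smem s u (f s r a).

Definition modal_image s r v : A -> Prop :=
  fun d => exists a, ~ smem r v a /\ d ⊑[s] f s r a.

Definition modal_rel s r u v : Prop := modal_preimage s r u ⊆ smem r v.

Definition canonical_rel u v : Prop := forall s r, modal_rel s r u v.

Lemma meet_preserving_mono s r a b : a ⊑[r] b -> f s r a ⊑[s] f s r b.
Proof. rewrite !(sle_meet lat). intros H. now rewrite <- f_meet, H. Qed.

Lemma meet_preserving_anti s r a b :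
  a ⊑[r] b -> f (opp s) r b ⊑[s] f (opp s) r a.
Proof. intros ab. apply sle_opp, meet_preserving_mono, ab. Qed.

Arguments meet_preserving_mono s [r a b].
Arguments meet_preserving_anti s [r a b].

Lemma modal_preimage_sfilter s r u : sfilter r (modal_preimage s r u).
Proof.
  unfold modal_preimage. split.
  - rewrite f_top. apply smem_top.
  - intros a b Ha Hb. rewrite f_meet. now apply smem_meet.
  - intros a b ab. apply (smem_le lat), meet_preserving_mono, ab.
Qed.

Lemma modal_image_sfilter s r v : sfilter (opp s) (modal_image s r v).
Proof.
  split.
  - exists (sbot r). split; [apply smem_bot|apply (sbot_sle lat)].
  - intros d d' (a & Ha & da) (a' & Ha' & da').
    exists (a ⊔[r] a'). split; [rewrite smem_join; tauto|].
    pose proof (meet_preserving_mono s (sjoin_l lat r a a')).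
    pose proof (meet_preserving_mono s (sjoin_r lat r a a')). lattice lat.
  - intros d d' dd' (a & Ha & da). exists a. split; [exact Ha|].
    rewrite !sle_opp in dd'. exact (sle_trans lat dd' da).
Qed.

Lemma modal_rel_image s r u v :
  modal_rel s r u v <-> disjoint (smem s u) (modal_image s r v).
Proof.
  split.
  - intros uv d Hd (a & Ha & da). apply Ha, uv. exact (smem_le lat u da Hd).
  - intros disj a Ha. apply NNPP. intros Hv. apply (disj _ Ha).
    exists a. split; [exact Hv|apply (sle_refl lat)].
Qed.

Lemma modal_rel_mono s r u u' v v' :
  ple s u u' -> modal_rel s r u' v' -> ple r v' v -> modal_rel s r u v.
Proof. intros uu' uv v'v a Ha. now apply v'v, uv, uu'. Qed.

Lemma canonical_rel_signs s r u v :
  modal_rel s r u v -> modal_rel s (opp r) u v ->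
  modal_rel (opp s) r u v -> modal_rel (opp s) (opp r) u v ->
  canonical_rel u v.
Proof. intros ? ? ? ? s' r'. destruct s, s', r, r'; assumption. Qed.

Record unimodal_at s r : Prop := {
  at_inner : forall a b, f s (opp r) a ⊓[s] f s r (a ⊔[r] b) ⊑[s] f s r b;
  at_outer : forall a c,
    f (opp s) r a ⊓[s] c ⊑[s] f s r a -> c ⊑[s] f s r a;
  at_both : forall a b c,
    f (opp s) (opp r) b ⊓[s] c ⊑[s] f s r a ->
    f s r (a ⊔[r] b) ⊓[s] c ⊑[s] f s r a
}.

Record fwd_local_at s r : Prop := {
  at_fwd_both : forall a b,
    f s r (a ⊔[r] b) ⊑[s] f s r a ⊔[s] f (opp s) (opp r) b;
  at_fwd_outer : forall a, stop s ⊑[s] f s r a ⊔[s] f (opp s) r a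
}.

(* The implications of the backward equations are replaced by elements with
   their defining property, so that the conditions make sense when the
   residuated connectives are not in the signature. *)
Record bwd_local_at s r : Prop := {
  at_bwd_both : forall a b c,
    f (opp s) (opp r) a ⊓[s] c ⊑[s] f s r b ->
    exists d, a ⊓[r] d ⊑[r] b /\ c ⊑[s] f s r d;
  at_bwd_inner : forall a,
    exists d, a ⊓[r] d ⊑[r] sbot r /\ f s (opp r) a ⊑[s] f s r d
}.

Lemma modal_rel_maximal s r u v : modal_rel s r u v ->
  exists u' v', ple s u u' /\ ple r v' v /\ modal_rel s r u' v' /\
    (forall d, ~ smem s u' d -> exists c a,
      smem s u' c /\ ~ smem r v' a /\ c ⊓[s] d ⊑[s] f s r a) /\
    (forall b, smem r v' b -> exists a,
      ~ smem r v' a /\ smem s u' (f s r (a ⊔[r] b))).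
Proof.
  intros uv.
  destruct (@prime_separation _ A lat s (smem s u) (modal_image s r v))
    as (u' & uu' & u'v & u'_max).
  { apply (smem_sfilter lat). }
  { apply modal_image_sfilter. }
  { now apply modal_rel_image. }
  destruct (@prime_separation _ A lat (opp r)
    (smem (opp r) v) (modal_preimage s r u')) as (v' & vv' & u'v' & v'_max).
  { apply (smem_sfilter lat). }
  { rewrite oppK. apply modal_preimage_sfilter. }
  { intros a Ha Ha'. apply smem_opp in Ha. apply Ha.
    exact (proj2 (modal_rel_image s r u' v) u'v a Ha'). }
  exists u', v'. split; [exact uu'|]. split; [now apply ple_opp|].
  split; [|split].
  - intros a Ha. apply NNPP. intros Hv'. apply smem_opp in Hv'.
    exact (u'v' a Hv' Ha).
  - intros d Hd. destruct (u'_max d Hd) as (c & Hc & a & Ha & H).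
    exists c, a. split; [exact Hc|]. split; [|exact H].
    apply smem_opp, vv', smem_opp, Ha.
  - intros b Hb. destruct (v'_max b) as (a & Ha & H).
    + rewrite smem_opp. tauto.
    + apply smem_opp in Ha. now exists a.
Qed.

Lemma modal_rel_generated s r u v : unimodal_at s r -> modal_rel s r u v ->
  exists u' v', ple s u u' /\ canonical_rel u' v' /\ ple r v' v.
Proof.
  intros ax uv.
  destruct (modal_rel_maximal uv) as (x & y & ux & yv & xy & x_max & y_max).
  exists x, y. split; [exact ux|]. split; [|exact yv].
  apply (@canonical_rel_signs s r); [exact xy|..];
    intros b Hb; unfold modal_preimage in Hb; rewrite ?smem_opp in *.
  - intros Hy. destruct (y_max b Hy) as (a & Ha & Hx). apply Ha, xy.
    apply (smem_le lat x (at_inner ax b a)), smem_meet. split; [exact Hb|].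
    rewrite (smeetC lat). exact Hx.
  - apply NNPP. intros Hy.
    destruct (x_max _ Hb) as (c & a & Hc & Ha & H).
    enough (Hab : smem r y (a ⊔[r] b)) by (apply smem_join in Hab; tauto).
    apply xy. refine (smem_le lat x (at_outer ax _ _ _) Hc).
    pose proof (meet_preserving_anti s (sjoin_r lat r a b)).
    pose proof (meet_preserving_mono s (sjoin_l lat r a b)). lattice lat.
  - intros Hy. destruct (x_max _ Hb) as (c & a & Hc & Ha & H).
    destruct (y_max b Hy) as (a' & Ha' & Hx).
    enough (Haa' : smem r y (a ⊔[r] a')) by (apply smem_join in Haa'; tauto).
    apply xy. refine (smem_le lat x (at_both ax (a ⊔[r] a') b c _) _).
    + pose proof (meet_preserving_mono s (sjoin_l lat r a a')). lattice lat.
    + apply smem_meet. split; [|exact Hc].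
      refine (smem_le lat x (meet_preserving_mono s _) Hx). lattice lat.
Qed.

Lemma fwd_local_disjoint s r u v' a b c :
  unimodal_at s r -> fwd_local_at s r -> modal_rel s r u v' ->
  smem s u (f s (opp r) c) -> ~ smem r v' a ->
  ~ smem s u (f (opp s) (opp r) b) ->
  ~ smem s u (f s r (c ⊔[r] (a ⊔[r] b))).
Proof.
  intros ax loc uv' Hc Ha Hb H. apply Ha, uv'.
  assert (Hab : smem s u (f s r (a ⊔[r] b))).
  { apply (smem_le lat u (at_inner ax c _)), smem_meet. now split. }
  apply (smem_le lat u (at_fwd_both loc a b)), smem_join in Hab. tauto.
Qed.

Lemma canonical_rel_fwd s r u v' :
  unimodal_at s r -> fwd_local_at s r -> modal_rel s r u v' ->
  exists v, canonical_rel u v /\ ple r v v'.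
Proof.
  intros ax loc uv'.
  pose (I := filter_join (opp r) (modal_preimage s (opp r) u)
    (filter_join (opp r) (smem (opp r) v') (modal_preimage (opp s) (opp r) u))).
  assert (inner_filter := modal_preimage_sfilter s (opp r) u).
  assert (both_filter := modal_preimage_sfilter (opp s) (opp r) u).
  assert (v'_filter := smem_sfilter lat (opp r) v').
  assert (join_filter := filter_join_sfilter lat v'_filter both_filter).
  destruct (@prime_separation _ A lat r (modal_preimage s r u) I)
    as (v & uv & vI & _).
  - apply modal_preimage_sfilter.
  - now apply (filter_join_sfilter lat).
  - intros d Hd (c & e & Hc & (a & b & Ha & Hb & abe) & ced).
    unfold modal_preimage in *. rewrite !smem_opp in *. rewrite !sle_opp in *.
    apply (@fwd_local_disjoint s r u v' a b c); trivial.
    refine (smem_le lat u (meet_preserving_mono s _) Hd). lattice lat.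
  - assert (I_v : I ⊆ smem (opp r) v).
    { intros a Ha. apply smem_opp. intros Hv. exact (vI a Hv Ha). }
    exists v. split; [apply (@canonical_rel_signs s r)|].
    + exact uv.
    + intros a Ha. apply I_v. now apply (filter_join_l lat).
    + intros a Ha. unfold modal_preimage in Ha. rewrite smem_opp in Ha.
      apply uv.
      pose proof (smem_le lat u (at_fwd_outer loc a) (smem_top s u)) as Hu.
      apply smem_join in Hu. unfold modal_preimage. tauto.
    + intros a Ha. apply I_v. apply (filter_join_r lat); [exact inner_filter|].
      now apply (filter_join_r lat).
    + apply ple_opp. intros a Ha. apply I_v.
      apply (filter_join_r lat); [exact inner_filter|].
      now apply (filter_join_l lat).
Qed.

Lemma bwd_local_disjoint s r u' v a b c a' b' :
  unimodal_at s r -> bwd_local_at s r -> modal_rel s r u' v ->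
  smem s u' c -> smem r v b -> ~ smem r v a -> ~ smem r v a' -> smem r v b' ->
  ~ f (opp s) (opp r) b ⊓[s] f (opp s) r a ⊓[s] c
      ⊑[s] f s r a' ⊔[s] f s (opp r) b'.
Proof.
  intros ax loc u'v Hc Hb Ha Ha' Hb' H.
  destruct (at_bwd_inner loc b') as (d & b'd & Hd).
  assert (nd : ~ smem r v d).
  { intros Hvd. apply (@smem_bot _ _ r v), (smem_le lat v b'd).
    now apply smem_meet. }
  pose (e := a ⊔[r] (a' ⊔[r] d)).
  assert (ne : ~ smem r v e) by (unfold e; rewrite !smem_join; tauto).
  assert (ae : a ⊑[r] e) by (unfold e; lattice lat).
  assert (a'e : a' ⊑[r] e) by (unfold e; lattice lat).
  assert (de : d ⊑[r] e) by (unfold e; lattice lat).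
  apply (meet_preserving_anti s) in ae.
  apply (meet_preserving_mono s) in a'e, de.
  assert (Hbc : f (opp s) (opp r) b ⊓[s] c ⊑[s] f s r e).
  { apply (at_outer ax). clear b'd. lattice lat. }
  destruct (at_bwd_both loc _ _ _ Hbc) as (g & bg & cg).
  apply ne, (smem_le lat v bg), smem_meet. split; [exact Hb|].
  apply u'v. exact (smem_le lat u' cg Hc).
Qed.

Lemma canonical_rel_bwd s r u' v :
  unimodal_at s r -> bwd_local_at s r -> modal_rel s r u' v ->
  exists u, ple s u' u /\ canonical_rel u v.
Proof.
  intros ax loc u'v.
  pose (F := filter_join s
    (filter_join s (modal_image (opp s) (opp r) v) (modal_image (opp s) r v))
    (smem s u')).
  pose (I := filter_join (opp s) (modal_image s r v) (modal_image s (opp r) v)).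
  assert (u'_filter := smem_sfilter lat s u').
  assert (both_filter := modal_image_sfilter (opp s) (opp r) v).
  assert (outer_filter := modal_image_sfilter (opp s) r v).
  rewrite oppK in both_filter, outer_filter.
  assert (join_filter := filter_join_sfilter lat both_filter outer_filter).
  destruct (@prime_separation _ A lat s F I) as (u & Fu & uI & _).
  - now apply (filter_join_sfilter lat).
  - apply (filter_join_sfilter lat); apply modal_image_sfilter.
  - intros x (d & c & (d1 & d2 & (b & Hb & bd) & (a & Ha & ad) & dd) & Hc & cd)
      (e1 & e2 & (a' & Ha' & ae) & (b' & Hb' & be) & ee).
    rewrite smem_opp in Hb, Hb'. apply NNPP in Hb, Hb'.
    rewrite !sle_opp in *.
    apply (@bwd_local_disjoint s r u' v a b c a' b'); trivial.
    lattice lat.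
  - assert (F_rel : forall r',
      modal_image (opp s) r' v ⊆ F -> modal_rel (opp s) r' u v).
    { intros r' HF. apply modal_rel_image. intros d Hd Hi.
      apply smem_opp in Hd. apply Hd, Fu, HF, Hi. }
    assert (I_rel : forall r', modal_image s r' v ⊆ I -> modal_rel s r' u v).
    { intros r' HI. apply modal_rel_image. intros d Hd Hi.
      exact (uI d Hd (HI d Hi)). }
    exists u. split; [|apply (@canonical_rel_signs s r)].
    + intros c Hc. apply Fu. now apply (filter_join_r lat).
    + apply I_rel, (filter_join_l lat), modal_image_sfilter.
    + apply I_rel, (filter_join_r lat), modal_image_sfilter.
    + apply F_rel. intros d Hd. apply (filter_join_l lat); [exact u'_filter|].
      now apply (filter_join_r lat).
    + apply F_rel. intros d Hd. apply (filter_join_l lat); [exact u'_filter|].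
      now apply (filter_join_l lat).
Qed.

End CanonicalRelation.

Arguments modal_preimage {S A} f s r u a.
Arguments modal_rel {S A} f s r u v.
Arguments canonical_rel {S A} f u v.
Arguments unimodal_at {S A} f s r.
Arguments fwd_local_at {S A} f s r.
Arguments bwd_local_at {S A} f s r.

(** * The canonical frame *)

Section Canonical.
Variables (S : signature) (A : algebra S).
Hypothesis HU : signed_unimodal A.
Implicit Types (s r : sign) (a b c : A) (u v w : point A).

Let lat : bounded_distributive_lattice A := su_lattice HU.

(* A modality outside the signature is interpreted by the least
   meet-preserving map, whose canonical relation holds between
   any two points. *)
Definition modal_ext s r a : A :=
  match Sumbool.sumbool_of_bool (modals S (op s r)) with
  | left h => modal A (op s r) h a
  | right _ =>
      if excluded_middle_informative (a = stop r) then stop s else sbot s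
  end.

Lemma modal_extE s r (h : modals S (op s r)) a :
  modal_ext s r a = modal A (op s r) h a.
Proof.
  unfold modal_ext. destruct (Sumbool.sumbool_of_bool _) as [k|k].
  - now rewrite (proof_irrelevance _ k h).
  - exfalso. unfold is_true in h. congruence.
Qed.

Lemma modal_ext_absent s r a : ~ modals S (op s r) ->
  a = stop r /\ modal_ext s r a = stop s \/
  a <> stop r /\ modal_ext s r a = sbot s.
Proof.
  intros no. unfold modal_ext.
  destruct (Sumbool.sumbool_of_bool _) as [h|h]; [contradiction|].
  destruct (excluded_middle_informative _); tauto.
Qed.

Lemma modal_ext_top s r : modal_ext s r (stop r) = stop s.
Proof.
  destruct (classic (modals S (op s r))) as [h|no].
  - rewrite (modal_extE _ _ h). apply (su_top HU).
  - destruct (modal_ext_absent s r (stop r) no); tauto.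
Qed.

Lemma modal_ext_meet s r a b :
  modal_ext s r (a ⊓[r] b) = modal_ext s r a ⊓[s] modal_ext s r b.
Proof.
  destruct (classic (modals S (op s r))) as [h|no].
  - rewrite !(modal_extE _ _ h). apply (su_meet HU).
  - destruct (modal_ext_absent s r a no) as [[-> ->]|[na ->]].
    + now rewrite !(smeet_stop lat).
    + rewrite (smeet_sbot lat).
      destruct (modal_ext_absent s r (a ⊓[r] b) no) as [[E _]|[_ E]];
        [|exact E].
      destruct na. apply (sle_antisym lat r); [apply (sle_stop lat)|].
      rewrite <- E. apply (smeet_l lat).
Qed.

Lemma modal_ext_unimodal s r :
  modals S (op s r) -> unimodal_at modal_ext s r.
Proof.
  intros h. split.
  - intros a b. rewrite !(modal_extE s r h).
    destruct (classic (modals S (op s (opp r)))) as [k|no].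
    + rewrite (modal_extE _ _ k). apply (su_inner HU).
    + destruct (modal_ext_absent s (opp r) a no) as [[-> ->]|[_ ->]].
      * rewrite (smeet_stop lat _ (modal A _ _ _)), (smeet_stop lat (opp r)).
        apply (sle_refl lat).
      * rewrite (smeet_sbot lat). apply (sbot_sle lat).
  - intros a c. rewrite !(modal_extE s r h).
    destruct (classic (modals S (op (opp s) r))) as [k|no].
    + rewrite (modal_extE _ _ k). apply (su_outer HU).
    + destruct (modal_ext_absent (opp s) r a no) as [[-> _]|[_ ->]].
      * intros _. rewrite (su_top HU). apply (sle_stop lat).
      * now rewrite oppK, (smeet_stop lat).
  - intros a b c. rewrite !(modal_extE s r h).
    destruct (classic (modals S (op (opp s) (opp r)))) as [k|no].
    + rewrite (modal_extE _ _ k). apply (su_both HU).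
    + destruct (modal_ext_absent (opp s) (opp r) b no) as [[-> _]|[_ ->]].
      * intros _. rewrite (smeetC lat (opp r)), (smeet_stop lat).
        apply (smeet_l lat).
      * rewrite oppK, (smeet_stop lat). intros H.
        exact (sle_trans lat (smeet_r lat s _ c) H).
Qed.

Lemma modal_ext_fwd_local s r : modals S (op s r) ->
  fwd_local_both A s r -> fwd_local_outer A s r -> fwd_local_at modal_ext s r.
Proof.
  intros h loc_both loc_outer. split.
  - intros a b. rewrite !(modal_extE s r h).
    destruct (classic (modals S (op (opp s) (opp r)))) as [k|no].
    + rewrite (modal_extE _ _ k). apply loc_both.
    + destruct (modal_ext_absent (opp s) (opp r) b no) as [[-> _]|[_ ->]].
      * rewrite (smeetC lat (opp r)), (smeet_stop lat). apply (sjoin_l lat).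
      * rewrite oppK.
        exact (sle_trans lat (sle_stop lat s _) (sjoin_r lat s _ _)).
  - intros a. rewrite !(modal_extE s r h).
    destruct (classic (modals S (op (opp s) r))) as [k|no].
    + rewrite (modal_extE _ _ k). apply loc_outer.
    + destruct (modal_ext_absent (opp s) r a no) as [[-> _]|[_ ->]].
      * rewrite (su_top HU). apply (sjoin_l lat).
      * rewrite oppK. apply (sjoin_r lat).
Qed.

Lemma modal_ext_bwd_local s r : modals S (op s r) ->
  signed_residuated A -> bwd_local_both A s r -> bwd_local_inner A s r ->
  (modals S (op (opp s) (opp r)) -> has_simp S s /\ has_simp S r) ->
  (modals S (op s (opp r)) -> has_simp S r) ->
  bwd_local_at modal_ext s r.
Proof.
  intros h res loc_both loc_inner simp_both simp_inner. split.
  - intros a b c. rewrite (modal_extE s r h b).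
    destruct (classic (modals S (op (opp s) (opp r)))) as [k|no].
    + rewrite (modal_extE _ _ k). intros H.
      destruct (simp_both k) as [i j]. exists (simp r j a b).
      split; [apply (res r j), (sle_refl lat)|]. rewrite (modal_extE s r h).
      refine (sle_trans lat _ (loc_both h k i j a b)). now apply (res s i).
    + destruct (modal_ext_absent (opp s) (opp r) a no) as [[-> _]|[_ ->]].
      * intros _. exists (stop r). rewrite (smeet_sbot lat), modal_ext_top.
        split; [apply (sbot_sle lat)|apply (sle_stop lat)].
      * rewrite oppK, (smeet_stop lat). intros H. exists b.
        rewrite (modal_extE s r h). split; [apply (smeet_r lat)|exact H].
  - intros a. destruct (classic (modals S (op s (opp r)))) as [k|no].
    + pose proof (simp_inner k) as j. exists (simp r j a (sbot r)).
      split; [apply (res r j), (sle_refl lat)|].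
      rewrite (modal_extE _ _ k), (modal_extE _ _ h). apply loc_inner.
    + destruct (modal_ext_absent s (opp r) a no) as [[-> ->]|[_ ->]].
      * exists (stop r). rewrite (smeet_sbot lat), modal_ext_top.
        split; apply (sle_refl lat).
      * exists (sbot r). split; [apply (smeet_r lat)|apply (sbot_sle lat)].
Qed.

Lemma modal_rel_absent s r u v :
  ~ modals S (op s r) -> modal_rel modal_ext s r u v.
Proof.
  intros no a Ha. unfold modal_preimage in Ha.
  destruct (modal_ext_absent s r a no) as [[-> _]|[_ E]].
  - apply smem_top.
  - rewrite E in Ha. now apply smem_bot in Ha.
Qed.

Lemma srel_ple s u v : srel s (ple pos) u v <-> ple s u v.
Proof. destruct s; [reflexivity|]. symmetry. apply (ple_opp pos). Qed.

Lemma generated_canonical_rel s r u v : modals S (op s r) ->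
  generated_rel (ple pos) (canonical_rel modal_ext) (op s r) u v <->
  modal_rel modal_ext s r u v.
Proof.
  intros h. rewrite generated_relE. split.
  - intros (y & (x & ux & xy) & yv). rewrite srel_ple in ux, yv.
    exact (modal_rel_mono ux (xy s r) yv).
  - intros uv.
    destruct (modal_rel_generated lat modal_ext_top modal_ext_meet
      (modal_ext_unimodal s r h) uv) as (x & y & ux & xy & yv).
    exists y. rewrite srel_ple. split; [|exact yv].
    exists x. now rewrite srel_ple.
Qed.

Lemma canonical_order : order (point A) (ple pos).
Proof.
  split.
  - intros u. apply ple_refl.
  - intros u v w. apply ple_trans.
  - intros u v. apply ple_antisym.
Qed.

Lemma canonical_inter u v :
  canonical_rel modal_ext u v <-> forall m, modals S m ->
    generated_rel (ple pos) (canonical_rel modal_ext) m u v.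
Proof.
  split.
  - intros uv m h. destruct (op_surj m) as (s & r & ->).
    now apply generated_canonical_rel.
  - intros H s r. destruct (classic (modals S (op s r))) as [h|no].
    + now apply generated_canonical_rel, H.
    + now apply modal_rel_absent.
Qed.

Definition canonical_frame : unimodal_frame (modals S) :=
  @UnimodalFrame (modals S) _ _ _ canonical_order canonical_inter.

Local Notation C := (complex_algebra S canonical_frame).

Definition canonical_map a : C :=
  exist (@is_upset S canonical_frame) (fun u => u a)
    (fun u v (uv : ple pos u v) => uv a).

Lemma smem_canonical_map s u a :
  smem s (@world_point S canonical_frame u) (canonical_map a) <-> smem s u a.
Proof. now destruct s. Qed.

Lemma canonical_map_inj a b : canonical_map a = canonical_map b -> a = b.
Proof.
  intros E.
  assert (same_points : forall u, smem pos u a <-> smem pos u b).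
  { intros u. now rewrite <- !smem_canonical_map, E. }
  apply (sle_antisym lat pos); apply (sle_points lat); apply same_points.
Qed.

Lemma canonical_map_smeet s a b :
  canonical_map (a ⊓[s] b) = canonical_map a ⊓[s] canonical_map b.
Proof.
  apply (complex_sext s). intros u.
  rewrite smem_meet, !smem_canonical_map. apply smem_meet.
Qed.

Lemma canonical_map_stop s : canonical_map (stop s) = stop s.
Proof.
  apply (complex_sext s). intros u. rewrite smem_canonical_map.
  split; intros; apply smem_top.
Qed.

Lemma canonical_map_simp s (i : has_simp S s) a b : signed_residuated A ->
  canonical_map (simp s i a b) = simp s i (canonical_map a) (canonical_map b).
Proof.
  intros res. apply (complex_sext s). intros u.
  rewrite wmem_simp, smem_canonical_map. split.
  - intros H w uw. rewrite !smem_canonical_map. intros Ha.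
    apply srel_ple in uw.
    apply (smem_le lat w) with (a ⊓[s] simp s i a b).
    + apply (res s i), (sle_refl lat).
    + apply smem_meet. split; [exact Ha|]. now apply uw.
  - intros H. apply NNPP. intros Hn.
    destruct (@prime_separation _ A lat s
      (filter_join s (sle s a) (smem s u)) (sle (opp s) b))
      as (w & Hw & Hb & _).
    + apply (filter_join_sfilter lat);
        [apply (principal_sfilter lat)|apply (smem_sfilter lat)].
    + apply (principal_sfilter lat).
    + intros d (a' & c & aa' & Hc & acd) bd. rewrite sle_opp in bd.
      apply Hn, (smem_le lat u) with c; [|exact Hc].
      apply (res s i). lattice lat.
    + apply (Hb b); [|apply (sle_refl lat)]. rewrite <- smem_canonical_map.
      apply H.
      * apply srel_ple. intros c Hc. apply Hw.
        apply (filter_join_r lat); [apply (principal_sfilter lat)|exact Hc].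
      * apply smem_canonical_map, Hw.
        apply (filter_join_l lat);
          [apply (smem_sfilter lat)|apply (sle_refl lat)].
Qed.

Lemma canonical_map_modal s r (h : modals S (op s r)) a :
  canonical_map (modal A (op s r) h a) = modal C (op s r) h (canonical_map a).
Proof.
  apply (complex_sext s). intros u.
  rewrite smem_canonical_map, wmem_modal_generated, <- modal_extE. split.
  - intros H v uv. apply smem_canonical_map.
    now apply (proj1 (generated_canonical_rel s r u v h) uv).
  - intros H. apply NNPP. intros Hn.
    destruct (@prime_separation _ A lat r
      (modal_preimage modal_ext s r u) (sle (opp r) a)) as (v & uv & Ha & _).
    + apply (modal_preimage_sfilter lat);
        [apply modal_ext_top|apply modal_ext_meet].
    + apply (principal_sfilter lat).
    + intros b Hb ab. apply Hn. rewrite sle_opp in ab.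
      apply (smem_le lat u) with (modal_ext s r b); [|exact Hb].
      apply (meet_preserving_mono lat); [apply modal_ext_meet|exact ab].
    + apply (Ha a); [|apply (sle_refl lat)]. rewrite <- smem_canonical_map.
      now apply H, generated_canonical_rel.
Qed.

Lemma canonical_embedding : signed_residuated A -> embedding A C canonical_map.
Proof.
  intros res. split.
  - apply canonical_map_inj.
  - apply (canonical_map_stop neg).
  - apply (canonical_map_stop pos).
  - apply (canonical_map_smeet pos).
  - apply (canonical_map_smeet neg).
  - intros i a b. now apply (canonical_map_simp pos).
  - intros j b a. now apply (canonical_map_simp neg).
  - intros m h a. destruct (op_surj m) as (s & r & ->).
    apply canonical_map_modal.
Qed.

Lemma canonical_fwd_local s r : modals S (op s r) ->
  fwd_local_both A s r -> fwd_local_outer A s r ->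
  frame_locality canonical_frame (fwd (op s r)).
Proof.
  intros h loc_both loc_outer. rewrite frame_locality_fwd.
  intros u v (x & ux & xv). apply srel_ple in ux.
  destruct (canonical_rel_fwd lat modal_ext_top modal_ext_meet
    (modal_ext_unimodal s r h) (modal_ext_fwd_local h loc_both loc_outer)
    (modal_rel_mono ux (xv s r) (ple_refl _ v))) as (y & uy & yv).
  exists y. split; [exact uy|]. now apply srel_ple.
Qed.

Lemma canonical_bwd_local s r : modals S (op s r) ->
  signed_residuated A -> bwd_local_both A s r -> bwd_local_inner A s r ->
  (modals S (op (opp s) (opp r)) -> has_simp S s /\ has_simp S r) ->
  (modals S (op s (opp r)) -> has_simp S r) ->
  frame_locality canonical_frame (bwd (adjoint (op s r))).
Proof.
  intros h res loc_both loc_inner simp_both simp_inner.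
  rewrite frame_locality_bwd.
  intros u v (x & ux & xv). apply srel_ple in xv.
  destruct (canonical_rel_bwd lat modal_ext_meet
    (modal_ext_unimodal s r h)
    (modal_ext_bwd_local h res loc_both loc_inner simp_both simp_inner)
    (modal_rel_mono (ple_refl _ u) (ux s r) xv)) as (y & uy & yv).
  exists y. split; [|exact yv]. now apply srel_ple.
Qed.

End Canonical.

Lemma local_has_simp_both (L : fmod -> bool) (L' : modality -> bool) s r :
  L' (bwd (adjoint (op s r))) -> L (op s r) -> L (op (opp s) (opp r)) ->
  has_simp (local_signature L L') s /\ has_simp (local_signature L L') r.
Proof.
  intros Hm h k.
  assert (E : in_force L L' (bwd (adjoint (op s r))) (smul s r)).
  { unfold in_force. rewrite Hm.
    destruct s, r; cbn in h, k |- *; now rewrite h, k. }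
  destruct s, r; split; apply requiresP;
    (eexists; eexists; split; [exact E|reflexivity]).
Qed.

Lemma local_has_simp_inner (L : fmod -> bool) (L' : modality -> bool) s r :
  L' (bwd (adjoint (op s r))) -> L (op s r) -> L (op s (opp r)) ->
  has_simp (local_signature L L') r.
Proof.
  intros Hm h k.
  assert (E : in_force L L' (bwd (adjoint (op s r))) (opp (smul s r))).
  { unfold in_force. rewrite Hm.
    destruct s, r; cbn in h, k |- *; now rewrite h, k. }
  destruct s, r; apply requiresP;
    (eexists; eexists; split; [exact E|reflexivity]).
Qed.

Lemma canonical_local L L' (A : algebra (local_signature L L'))
    (HU : signed_unimodal A) :
  (forall m, L' m -> L (base m)) -> signed_residuated A -> signed_local L' A ->
  local_frame L' (canonical_frame HU).
Proof.
  intros HL' res loc [m|m] Hm; pose proof (HL' _ Hm) as h; cbn in h.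
  - destruct (op_surj m) as (s & r & ->). apply canonical_fwd_local.
    + exact h.
    + now apply (sl_fwd_both loc).
    + now apply (sl_fwd_outer loc).
  - rewrite <- (adjointK m) in Hm |- *.
    destruct (op_surj (adjoint m)) as (s & r & E). rewrite E in *.
    apply canonical_bwd_local.
    + exact h.
    + exact res.
    + now apply (sl_bwd_both loc).
    + now apply (sl_bwd_inner loc).
    + now apply local_has_simp_both.
    + now apply local_has_simp_inner.
Qed.

Theorem mainTheorem12 (L : fmod -> bool) (L' : modality -> bool)
    (HL' : forall m : modality, L' m -> L (base m)) :
  generated_as_universal_class
    (@local_unimodal_algebra L L') (@local_complex_algebra L L').
Proof.
  split; [|split].
  - apply local_unimodal_universal.
  - apply complex_local_unimodal.
  - intros K K_universal K_complex A HA.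
    apply local_unimodal_signedP in HA as (HU & res & loc).
    apply (universal_class_embedding (canonical_embedding HU res)).
    + exact K_universal.
    + apply K_complex. exists (canonical_frame HU).
      split; [now apply canonical_local|reflexivity].
Qed.
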